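(* Let $U\subset\mathbb{R}^2$ be a simply connected open set with coordinates $(u,v)$. Suppose that $a,b$ and $c$ are three functions on $U$ which satisfy the integrability conditions $$a_u=0,\qquad b_{uu}=0,\qquad c_u=2b.$$ Then there exists a normal $p$-minimal parametrized surface $F:U\to H^1$ having $a,b$ and $c$ as its coefficients of the first kind, and its coefficient $m$ of the second kind is determined by $b$ as $m=b_u$. In addition, if $\widetilde F:U\to H^1$ is another such normal $p$-minimal parametrized surface, then it differs from $F$ by a Heisenberg rigid motion, that is, there exists $g\in PSH(1)$ such that $\widetilde F(u,v)=g\circ F(u,v)$ for all $(u,v)\in U$.
   Context: All functions and maps are smooth. $H^1$ is $\mathbb{R}^3$ with group law $(x_1,y_1,z_1)\circ(x_2,y_2,z_2)=(x_1+x_2,\,y_1+y_2,\,z_1+z_2+y_1x_2-x_1y_2)$ and left invariant vector fields $\mathring e_1=\partial_x+y\,\partial_z$, $\mathring e_2=\partial_y-x\,\partial_z$, $T=\partial_z$. The contact form is $\theta_0=dz+x\,dy-y\,dx$, the contact bundle is $\xi_0=\ker\theta_0=\mathrm{span}(\mathring e_1,\mathring e_2)$, and $J_0\mathring e_1=\mathring e_2$, $J_0\mathring e_2=-\mathring e_1$. $\langle\cdot,\cdot\rangle$ is the Riemannian metric on $H^1$ for which $\mathring e_1,\mathring e_2,T$ are orthonormal. $PSH(1)$ is the group of pseudohermitian transformations (Heisenberg rigid motions): diffeomorphisms $\Phi$ of $H^1$ with $\Phi^*\theta_0=\theta_0$ and $\Phi_*J_0=J_0\Phi_*$ on $\xi_0$.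 A point of a surface is singular if the tangent plane of the surface there equals the contact plane $\xi_0$; away from singular points the line field (tangent plane)$\,\cap\,\xi_0$ integrates to the characteristic foliation. A parametrized surface $F:U\to H^1$ is normal if (1) $F(U)$ is a surface without singular points; (2) $F_u=\partial F/\partial u$ defines the characteristic foliation on $F(U)$; (3) $|F_u|=1$ on $U$. For a normal $F$, put $X=F_u$, $Y=J_0X$; its coefficients of the first kind are $a=\langle F_v,X\rangle$, $b=\langle F_v,Y\rangle$, $c=\langle F_v,T\rangle$, and of the second kind $l=\langle F_{uu},Y\rangle$, $m=\langle F_{uv},Y\rangle$, where $F_{uu},F_{uv}$ are componentwise second partial derivatives of the $\mathbb{R}^3$-valued map $F$ (components with respect to $\partial_x,\partial_y,\partial_z$), regarded as tangent vectors at $F(u,v)$. The function $l$ is the $p$-mean curvature; a normal parametrized surface is $p$-minimal if $l=0$ on $U$.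
   Formalization: The function c is additionally assumed to vanish nowhere on U, which every normal parametrized surface forces (a=b=c=0 satisfies the integrability conditions but gives F_v=0); surfaces are understood as immersed, not necessarily injective. *)

(* Defs.v *)
From Stdlib Require Import Reals Lra.
From Coquelicot Require Import Coquelicot.
Local Open Scope R_scope.

(** * The Heisenberg group *)

(* Used both for points (x, y, z) and for tangent vectors; a tangent vector is
   given by its components with respect to d/dx, d/dy, d/dz, and the point it
   is attached to is passed separately. *)
Definition H1 : Type := (R * R * R)%type.

Definition cx (p : H1) : R := fst (fst p).
Definition cy (p : H1) : R := snd (fst p).
Definition cz (p : H1) : R := snd p.

Definition e1 (p : H1) : H1 := (1, 0, cy p).
Definition e2 (p : H1) : H1 := (0, 1, - cx p).
Definition eT (p : H1) : H1 := (0, 0, 1).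

Definition theta0 (p v : H1) : R := cz v + cx p * cy v - cy p * cx v.

Definition contact (p v : H1) : Prop := theta0 p v = 0.

Lemma H1_eq (v w : H1) : cx v = cx w -> cy v = cy w -> cz v = cz w -> v = w.
Proof.
destruct v as [[? ?] ?], w as [[? ?] ?]; unfold cx, cy, cz; simpl.
intros -> -> ->; reflexivity.
Qed.

(* The coefficients of v in the frame are cx v, cy v, theta0 p v, which gives
   the formulas for the metric and for J0 below; J0 is only meaningful on
   contact vectors. *)
Lemma frame_decomposition (p v : H1) :
  v = plus (plus (scal (cx v) (e1 p)) (scal (cy v) (e2 p)))
           (scal (theta0 p v) (eT p)).
Proof.
apply H1_eq;
  [change (cx v = cx v * 1 + cy v * 0 + theta0 p v * 0)
  |change (cy v = cx v * 0 + cy v * 1 + theta0 p v * 0)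
  |change (cz v = cx v * cy p + cy v * - cx p + theta0 p v * 1)];
  unfold theta0; ring.
Qed.

Definition metric (p v w : H1) : R :=
  cx v * cx w + cy v * cy w + theta0 p v * theta0 p w.

Definition J0 (p v : H1) : H1 :=
  minus (scal (cx v) (e2 p)) (scal (cy v) (e1 p)).

(** * Smooth functions and maps *)

(* [ex_diff_n f n u v] is Coquelicot's "all partial derivatives up to order n
   exist and are continuous" for functions of two real variables. *)
Definition smooth2 (U : R * R -> Prop) (f : R -> R -> R) : Prop :=
  forall u v, U (u, v) -> forall n, ex_diff_n f n u v.

Definition smooth_surface_map (U : R * R -> Prop) (F : R -> R -> H1) : Prop :=
  smooth2 U (fun u v => cx (F u v)) /\
  smooth2 U (fun u v => cy (F u v)) /\
  smooth2 U (fun u v => cz (F u v)).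

Definition ex_Dx (f : H1 -> R) (p : H1) : Prop :=
  ex_derive (fun t : R => f (t, cy p, cz p)) (cx p).
Definition ex_Dy (f : H1 -> R) (p : H1) : Prop :=
  ex_derive (fun t : R => f (cx p, t, cz p)) (cy p).
Definition ex_Dz (f : H1 -> R) (p : H1) : Prop :=
  ex_derive (fun t : R => f (cx p, cy p, t)) (cz p).

Definition Dx (f : H1 -> R) (p : H1) : R :=
  Derive (fun t => f (t, cy p, cz p)) (cx p).
Definition Dy (f : H1 -> R) (p : H1) : R :=
  Derive (fun t => f (cx p, t, cz p)) (cy p).
Definition Dz (f : H1 -> R) (p : H1) : R :=
  Derive (fun t => f (cx p, cy p, t)) (cz p).

(* The three-variable analogue of [ex_diff_n]. *)
Fixpoint ex_diff3_n (f : R * R * R -> R) (n : nat) (p : R * R * R) : Prop :=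
  continuous f p /\
  match n with
  | O => True
  | S k =>
      (ex_Dx f p /\ ex_Dy f p /\ ex_Dz f p) /\
      ex_diff3_n (Dx f) k p /\ ex_diff3_n (Dy f) k p /\ ex_diff3_n (Dz f) k p
  end.

Definition smooth3 (f : H1 -> R) : Prop := forall p n, ex_diff3_n f n p.

Definition smooth_map (Phi : H1 -> H1) : Prop :=
  smooth3 (fun p => cx (Phi p)) /\
  smooth3 (fun p => cy (Phi p)) /\
  smooth3 (fun p => cz (Phi p)).

Definition dfun (f : H1 -> R) (p v : H1) : R :=
  Dx f p * cx v + Dy f p * cy v + Dz f p * cz v.

Definition dmap (Phi : H1 -> H1) (p v : H1) : H1 :=
  (dfun (fun q => cx (Phi q)) p v,
   dfun (fun q => cy (Phi q)) p v,
   dfun (fun q => cz (Phi q)) p v).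

Definition diffeomorphism (Phi : H1 -> H1) : Prop :=
  smooth_map Phi /\
  exists Psi : H1 -> H1,
    smooth_map Psi /\
    (forall p, Psi (Phi p) = p) /\ (forall p, Phi (Psi p) = p).

Definition PSH1 (Phi : H1 -> H1) : Prop :=
  diffeomorphism Phi /\
  (forall p v, theta0 (Phi p) (dmap Phi p v) = theta0 p v) /\
  (forall p v, contact p v ->
     dmap Phi p (J0 p v) = J0 (Phi p) (dmap Phi p v)).

(** * Simply connected plane domains *)

Definition I01 (t : R) : Prop := 0 <= t <= 1.

Definition I01sq (q : R * R) : Prop := I01 (fst q) /\ I01 (snd q).

Definition path_in (U : R * R -> Prop) (gamma : R -> R * R) : Prop :=
  continuous_on I01 gamma /\ forall t, I01 t -> U (gamma t).

Definition path_connected (U : R * R -> Prop) : Prop :=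
  forall p q, U p -> U q ->
    exists gamma, path_in U gamma /\ gamma 0 = p /\ gamma 1 = q.

(* For loops: the homotopy is relative to the base point gamma 0. *)
Definition null_homotopic (U : R * R -> Prop) (gamma : R -> R * R) : Prop :=
  exists H : R * R -> R * R,
    continuous_on I01sq H /\
    (forall q, I01sq q -> U (H q)) /\
    (forall t, I01 t -> H (t, 0) = gamma t) /\
    (forall t, I01 t -> H (t, 1) = gamma 0) /\
    (forall s, I01 s -> H (0, s) = gamma 0 /\ H (1, s) = gamma 0).

Definition simply_connected (U : R * R -> Prop) : Prop :=
  path_connected U /\
  forall gamma, path_in U gamma -> gamma 0 = gamma 1 -> null_homotopic U gamma.

(** * Parametrized surfaces *)

(* A map on U is a total function of which only the values on U are used. *)

Definition Du (f : R -> R -> R) (u v : R) : R := Derive (fun s => f s v) u.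
Definition Dv (f : R -> R -> R) (u v : R) : R := Derive (fun s => f u s) v.

Definition DFu (F : R -> R -> H1) (u v : R) : H1 :=
  (Du (fun s t => cx (F s t)) u v,
   Du (fun s t => cy (F s t)) u v,
   Du (fun s t => cz (F s t)) u v).
Definition DFv (F : R -> R -> H1) (u v : R) : H1 :=
  (Dv (fun s t => cx (F s t)) u v,
   Dv (fun s t => cy (F s t)) u v,
   Dv (fun s t => cz (F s t)) u v).

Definition immersive_at (F : R -> R -> H1) (u v : R) : Prop :=
  forall s t : R,
    plus (scal s (DFu F u v)) (scal t (DFv F u v)) = (0, 0, 0) ->
    s = 0 /\ t = 0.

Definition tangent (F : R -> R -> H1) (u v : R) (w : H1) : Prop :=
  exists s t : R, w = plus (scal s (DFu F u v)) (scal t (DFv F u v)).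

Definition singular_at (F : R -> R -> H1) (u v : R) : Prop :=
  forall w, tangent F u v w <-> contact (F u v) w.

(* A surface is understood as an immersed one: the parametrization is regular
   but not required to be injective. *)
Definition normal_surface (U : R * R -> Prop) (F : R -> R -> H1) : Prop :=
  smooth_surface_map U F /\
  (forall u v, U (u, v) -> immersive_at F u v /\ ~ singular_at F u v) /\
  (forall u v, U (u, v) -> forall w,
     (tangent F u v w /\ contact (F u v) w) <->
     (exists s : R, w = scal s (DFu F u v))) /\
  (forall u v, U (u, v) ->
     sqrt (metric (F u v) (DFu F u v) (DFu F u v)) = 1).

Definition frameX (F : R -> R -> H1) (u v : R) : H1 := DFu F u v.
Definition frameY (F : R -> R -> H1) (u v : R) : H1 := J0 (F u v) (frameX F u v).

Definition coef_a (F : R -> R -> H1) (u v : R) : R :=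
  metric (F u v) (DFv F u v) (frameX F u v).
Definition coef_b (F : R -> R -> H1) (u v : R) : R :=
  metric (F u v) (DFv F u v) (frameY F u v).
Definition coef_c (F : R -> R -> H1) (u v : R) : R :=
  metric (F u v) (DFv F u v) (eT (F u v)).

Definition coef_l (F : R -> R -> H1) (u v : R) : R :=
  metric (F u v) (DFu (DFu F) u v) (frameY F u v).
Definition coef_m (F : R -> R -> H1) (u v : R) : R :=
  metric (F u v) (DFv (DFu F) u v) (frameY F u v).

Definition normal_pminimal (U : R * R -> Prop) (F : R -> R -> H1) : Prop :=
  normal_surface U F /\ forall u v, U (u, v) -> coef_l F u v = 0.

Definition has_first_coefs (U : R * R -> Prop) (F : R -> R -> H1)
    (a b c : R -> R -> R) : Prop :=
  forall u v, U (u, v) ->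
    coef_a F u v = a u v /\ coef_b F u v = b u v /\ coef_c F u v = c u v.

(* Hence only nowhere vanishing functions can occur as the coefficient c. *)
Lemma normal_coef_c_neq0 (U : R * R -> Prop) (F : R -> R -> H1) :
  normal_surface U F -> forall u v, U (u, v) -> coef_c F u v <> 0.
Proof.
intros (_ & Hreg & Hchar & _) u v Huv Hc.
destruct (Hreg u v Huv) as [Himm _].
assert (Hcv : contact (F u v) (DFv F u v)).
{ unfold contact; rewrite <- Hc; unfold coef_c, metric.
  change (cx (eT (F u v))) with 0; change (cy (eT (F u v))) with 0.
  replace (theta0 (F u v) (eT (F u v))) with 1; [ring|].
  unfold theta0, eT, cx, cy, cz; simpl; ring. }
assert (Htv : tangent F u v (DFv F u v)).
{ exists 0, 1; set (w := DFu F u v); set (w' := DFv F u v).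
  apply H1_eq;
    [change (cx w' = 0 * cx w + 1 * cx w')
    |change (cy w' = 0 * cy w + 1 * cy w')
    |change (cz w' = 0 * cz w + 1 * cz w')]; ring. }
destruct (proj1 (Hchar u v Huv _) (conj Htv Hcv)) as [s Hs].
destruct (Himm s (-1)) as [_ H]; [|lra].
rewrite Hs; set (w := DFu F u v).
apply H1_eq;
  [change (s * cx w + -1 * (s * cx w) = 0)
  |change (s * cy w + -1 * (s * cy w) = 0)
  |change (s * cz w + -1 * (s * cz w) = 0)]; ring.
Qed.

(* Main.v *)
(* A normal p-minimal F = (x, y, z) has F_u = (p, q, y p - x q) with p^2 + q^2 = 1.
   The condition l = 0 makes p and q independent of u, and x_uv = x_vu, y_uv = y_vu
   give p_v = - b_u q and q_v = b_u p.  So F solves a first-order system whose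
   right-hand side involves only a, b, c.
   Existence: write p = cos th, q = sin th with dth = b_u dv; the integrability
   conditions say exactly that the forms defining th, x, y and z are closed, so the
   Poincare lemma on the simply connected domain U integrates them in turn.
   Uniqueness: for two solutions p' p + q' q and q' p - p' q have zero gradient,
   hence are the cosine and sine of a constant angle; after the corresponding
   rotation the coordinates differ by the constants of a left translation.
   The Poincare lemma is deduced from a statement about additive cocycles: if
   I(x, y) + I(y, z) = I(x, z) holds for points of a common ball in U, then the sums
   of I along ever finer dyadic subdivisions of a path stabilize, and are homotopy
   invariant because I sums to zero around every small cell of a grid. *)
Require Import Defs.
From Stdlib Require Import Reals Lra Lia Classical IndefiniteDescription.
From Coquelicot Require Import Coquelicot.
Local Open Scope R_scope.

(** * Local cocycles on a simply connected domain *)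

(** Models the integral of a closed 1-form from [x] to [y]. The identity is required only inside one
    ball contained in [U]; balls of [R * R] are open squares, hence convex and closed under mixing
    coordinates of their points. *)
Definition local_cocycle (U : R * R -> Prop) (I : R * R -> R * R -> R) : Prop :=
  forall p r x y z, (forall q, ball p r q -> U q) ->
    ball p r x -> ball p r y -> ball p r z -> I x y + I y z = I x z.

(** Halving at the midpoint lets refinement, concatenation at 1/2 and the subdivision of a square
    follow the recursion. The order of [s] and [t] is free, which covers reversed paths. *)
Fixpoint dyadic_sum (I : R * R -> R * R -> R) (n : nat) (g : R -> R * R)
    (s t : R) : R :=
  match n with
  | O => I (g s) (g t)
  | S k => dyadic_sum I k g s ((s + t) / 2) + dyadic_sum I k g ((s + t) / 2) t
  end.

(** [d] is a Lebesgue number along [g]. Only [s] is confined to [0,1]; the nearby [s'] may leave it,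
    so [g] has to behave well on a neighbourhood too. *)
Definition fine (U : R * R -> Prop) (g : R -> R * R) (d : R) : Prop :=
  0 < d /\
  forall s, I01 s -> exists p r, (forall q, ball p r q -> U q) /\
    forall s', Rabs (s' - s) < d -> ball p r (g s').

Definition fine2 (U : R * R -> Prop) (H : R -> R -> R * R) (d : R) : Prop :=
  0 < d /\
  forall s t, I01 s -> I01 t -> exists p r, (forall q, ball p r q -> U q) /\
    forall s' t', Rabs (s' - s) < d -> Rabs (t' - t) < d -> ball p r (H s' t').

(* A Lebesgue number for the cover of U by the balls contained in it. *)
Lemma fine2_exists (U : R * R -> Prop) (H : R -> R -> R * R) :
  open U -> (forall s t, U (H s t)) ->
  (forall q : R * R, continuous (fun q : R * R => H (fst q) (snd q)) q) ->
  exists d, fine2 U H d.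
Proof.
intros HU HH Hc.
assert (loc : forall st : R * R, exists d : posreal,
  exists r : R, (forall q, ball (H (fst st) (snd st)) r q -> U q) /\
   forall s' t', Rabs (s' - fst st) < 2 * d -> Rabs (t' - snd st) < 2 * d ->
     ball (H (fst st) (snd st)) r (H s' t')).
{ intros [s t]; simpl.
  destruct (HU _ (HH s t)) as [e He].
  pose proof (proj1 (filterlim_locally _ _) (Hc (s, t)) e) as [d Hd]; simpl in Hd.
  (* Half of the continuity radius, so that the tolerance [2 * d] in [loc] stays within it. The
     doubling later absorbs the distance from [s] to the centre [u]. *)
  exists (pos_div_2 d), e; split; [exact He|].
  intros s' t' Hs Ht; apply (Hd (s', t')); simpl in Hs, Ht.
  split; [change (Rabs (s' - s) < d)|change (Rabs (t' - t) < d)]; lra. }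
destruct (functional_choice _ loc) as [delta Hdelta].
destruct (compactness_value_2d 0 1 0 1 (fun u v => delta (u, v))) as [d Hd].
exists d; split; [apply cond_pos|]; intros s t Hs Ht.
(* Compactness gives the centre only under a double negation, hence the argument by
   contradiction. *)
apply NNPP; intros K; apply (Hd s t Hs Ht); intros (u & v & Hu & Hv & Hsu & Htv & Hle).
apply K; destruct (Hdelta (u, v)) as [r [Hr1 Hr2]]; exists (H u v), r.
split; [exact Hr1|]; intros s' t' Hs' Ht'; apply Hr2; simpl.
- replace (s' - u) with ((s' - s) + (s - u)) by ring.
  eapply Rle_lt_trans; [apply Rabs_triang|lra].
- replace (t' - v) with ((t' - t) + (t - v)) by ring.
  eapply Rle_lt_trans; [apply Rabs_triang|lra].
Qed.

Lemma fine_exists (U : R * R -> Prop) (g : R -> R * R) :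
  open U -> (forall s, U (g s)) -> (forall s, continuous g s) ->
  exists d, fine U g d.
Proof.
intros HU Hg Hc.
destruct (fine2_exists U (fun s _ => g s) HU) as [d [Hd K]].
- intros s _; apply Hg.
- intros q; apply (continuous_comp fst g); [apply continuous_fst|apply Hc].
- exists d; split; [exact Hd|]; intros s Hs.
  destruct (K s 0 Hs) as [p [r [K1 K2]]]; [split; lra|].
  exists p, r; split; [exact K1|]; intros s' Hs'; apply (K2 s' 0 Hs').
  rewrite Rminus_0_r, Rabs_R0; exact Hd.
Qed.

(** At depth [n] every piece is shorter than [d], so its endpoints and midpoint lie in one ball,
    where the cocycle identity merges the two halves. *)
Lemma dyadic_sum_refine (U : R * R -> Prop) I g d n s t :
  local_cocycle U I -> fine U g d -> 0 <= s -> s <= t -> t <= 1 ->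
  t - s < d * 2 ^ n -> dyadic_sum I (S n) g s t = dyadic_sum I n g s t.
Proof.
intros HI [Hd Hf]; revert s t; induction n as [|n IH]; intros s t H0 Hst H1 Hl.
- simpl in *; destruct (Hf s) as [p [r [K1 K2]]]; [split; lra|].
  apply (HI p r); [exact K1| | |]; apply K2; apply Rabs_def1; lra.
- change (dyadic_sum I (S n) g s ((s + t) / 2) + dyadic_sum I (S n) g ((s + t) / 2) t
    = dyadic_sum I n g s ((s + t) / 2) + dyadic_sum I n g ((s + t) / 2) t).
  simpl in Hl; rewrite !IH; try lra; reflexivity.
Qed.

(** A discrete Stokes theorem: a cell smaller than [d] is mapped into one ball, where both ways
    around it give the same value. *)
Lemma dyadic_sum_square (U : R * R -> Prop) I H d n s s' t t' :
  local_cocycle U I -> fine2 U H d ->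
  0 <= s -> s <= s' -> s' <= 1 -> 0 <= t -> t <= t' -> t' <= 1 ->
  s' - s < d * 2 ^ n -> t' - t < d * 2 ^ n ->
  dyadic_sum I n (fun x => H x t) s s' + dyadic_sum I n (fun y => H s' y) t t' =
  dyadic_sum I n (fun y => H s y) t t' + dyadic_sum I n (fun x => H x t') s s'.
Proof.
intros HI [Hd Hf]; revert s s' t t'.
induction n as [|n IH]; intros s s' t t' S0 Ss S1 T0 Tt T1 Sl Tl.
- simpl in *; destruct (Hf s t) as [p [r [K1 K2]]]; [split; lra|split; lra|].
  rewrite !(HI p r); try exact K1; try reflexivity; apply K2; apply Rabs_def1; lra.
- simpl in *.
  set (m := (s + s') / 2); set (k := (t + t') / 2).
  assert (Hm : m = (s + s') / 2) by reflexivity.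
  assert (Hk : k = (t + t') / 2) by reflexivity.
  clearbody m k.
  (* Adding the identities of the four quarter squares cancels the inner edges along [m] and [k]. *)
  assert (E1 := IH s m t k); assert (E2 := IH m s' t k).
  assert (E3 := IH s m k t'); assert (E4 := IH m s' k t').
  lra.
Qed.

(** Affine maps preserve midpoints, hence dyadic subdivisions. Slope 2 serves concatenation, slope
    -1 reversal, and slope 1 with shift 0 is extensionality on an interval. *)
Lemma dyadic_sum_reparam I n g h k c s t :
  s <= t -> (forall x, s <= x <= t -> g x = h (k * x + c)) ->
  dyadic_sum I n g s t = dyadic_sum I n h (k * s + c) (k * t + c).
Proof.
revert s t; induction n as [|n IH]; intros s t Hst E; simpl.
- rewrite !E by lra; reflexivity.
- rewrite !IH; try lra; [|intros x Hx; apply E; lra|intros x Hx; apply E; lra].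
  replace ((k * s + c + (k * t + c)) / 2) with (k * ((s + t) / 2) + c) by field.
  reflexivity.
Qed.

Lemma local_cocycle_refl (U : R * R -> Prop) I p : open U -> local_cocycle U I -> U p -> I p p = 0.
Proof.
intros HU HI Hp; destruct (HU p Hp) as [e He].
assert (B : ball p e p) by apply ball_center.
assert (E := HI p e p p p He B B B); lra.
Qed.

Lemma dyadic_sum_const (U : R * R -> Prop) I n p s t :
  open U -> local_cocycle U I -> U p -> dyadic_sum I n (fun _ => p) s t = 0.
Proof.
intros HU HI Hp; revert s t; induction n as [|n IH]; intros s t; simpl.
- apply (local_cocycle_refl U); assumption.
- rewrite !IH; ring.
Qed.

(** Inside a ball, going forth and back sums to [I x x], and [I x x + I x x = I x x] makes this
    zero. So [I] is antisymmetric on short pieces. *)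
Lemma dyadic_sum_rev (U : R * R -> Prop) I g d n s t :
  local_cocycle U I -> fine U g d -> 0 <= s -> s <= t -> t <= 1 ->
  t - s < d * 2 ^ n ->
  dyadic_sum I n g t s = - dyadic_sum I n g s t.
Proof.
intros HI [Hd Hf]; revert s t; induction n as [|n IH]; intros s t H0 Hst H1 Hl.
- simpl in *; destruct (Hf s) as [p [r [K1 K2]]]; [split; lra|].
  assert (Bs : ball p r (g s)) by (apply K2; apply Rabs_def1; lra).
  assert (Bt : ball p r (g t)) by (apply K2; apply Rabs_def1; lra).
  assert (E := HI p r _ _ _ K1 Bs Bt Bs).
  assert (E' := HI p r _ _ _ K1 Bs Bs Bs). lra.
- simpl in *; rewrite (Rplus_comm t s), (IH ((s + t) / 2) t), (IH s ((s + t) / 2)); lra.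
Qed.

(** * Paths, their concatenation and reversal *)

Definition path (U : R * R -> Prop) (g : R -> R * R) (p q : R * R) : Prop :=
  (forall s, continuous g s) /\ (forall s, U (g s)) /\ g 0 = p /\ g 1 = q.

(** Precomposition with this retraction onto [0,1] makes a path known only on [0,1] continuous and
    [U]-valued on all of R, as [path] demands. *)
Definition clamp (t : R) : R := Rmax 0 (Rmin t 1).

Lemma clamp_I01 t : I01 (clamp t).
Proof.
unfold clamp, I01; split; [apply Rmax_l|].
apply Rmax_lub; [lra|apply Rmin_r].
Qed.

Lemma clamp_id t : I01 t -> clamp t = t.
Proof. intros [? ?]; unfold clamp; rewrite Rmin_left, Rmax_right; lra. Qed.

Lemma clamp_lip s t : Rabs (clamp s - clamp t) <= Rabs (s - t).
Proof.
unfold clamp, Rmax, Rmin.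
repeat destruct (Rle_dec _ _); unfold Rabs; repeat destruct (Rcase_abs _); lra.
Qed.

Lemma continuous_clamp t : continuous clamp t.
Proof.
apply filterlim_locally; intros e; exists e; intros s Hs.
change (Rabs (clamp s - clamp t) < e); change (Rabs (s - t) < e) in Hs.
eapply Rle_lt_trans; [apply clamp_lip|exact Hs].
Qed.

(** As [r] takes all its values in [D], continuity relative to [D] becomes plain continuity after
    composition. *)
Lemma continuous_on_clamp {T V : UniformSpace} (D : T -> Prop) (f : T -> V) (r : T -> T) x :
  continuous_on D f -> (forall y, D (r y)) -> continuous r x ->
  continuous (fun y => f (r y)) x.
Proof.
intros Hf HD Hr.
intros P HP; specialize (Hf (r x) (HD x) P HP); unfold filtermap, within in *.
specialize (Hr _ Hf); unfold filtermap in Hr.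
revert Hr; apply filter_imp; intros y Hy; apply Hy, HD.
Qed.

Lemma path_of_path_in (U : R * R -> Prop) g : path_in U g -> path U (fun t => g (clamp t)) (g 0) (g 1).
Proof.
intros [Hc HU]; repeat split.
- intros s; apply (continuous_on_clamp I01 g clamp s Hc clamp_I01), continuous_clamp.
- intros s; apply HU, clamp_I01.
- rewrite clamp_id; [reflexivity|split; lra].
- rewrite clamp_id; [reflexivity|split; lra].
Qed.

Lemma path_in_of_path (U : R * R -> Prop) g p q : path U g p q -> path_in U g.
Proof.
intros (Hc & HU & _ & _); split; [|intros; apply HU].
intros x _ P HP; specialize (Hc x P HP); unfold filtermap, within in *.
revert Hc; apply filter_imp; auto.
Qed.

Lemma path_rev (U : R * R -> Prop) g p q : path U g p q -> path U (fun t => g (1 - t)) q p.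
Proof.
intros (Hc & HU & H0 & H1); repeat split; [|intros; apply HU| |].
- intros s; apply (continuous_comp (fun t => 1 - t) g); [|apply Hc].
  apply (continuous_minus (fun _ => 1) (fun t => t)); [apply continuous_const|apply continuous_id].
- rewrite Rminus_0_r; exact H1.
- rewrite Rminus_eq_0; exact H0.
Qed.

(** The clamps freeze each piece at its endpoints: values outside [0,1] stay in [U], and each piece
    is constant while the other one runs. *)
Definition path_cat (g h : R -> R * R) (t : R) : R * R :=
  if Rle_dec t (1 / 2) then g (clamp (2 * t)) else h (clamp (2 * t - 1)).

Lemma path_cat_spec (U : R * R -> Prop) g h p q r : path U g p q -> path U h q r ->
  path U (path_cat g h) p r.
Proof.
intros (Gc & GU & G0 & G1) (Hc & HU & H0 & H1).
(* A form without case distinction, from which continuity is immediate. *)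
assert (Ex : forall t, path_cat g h t =
  plus (minus (g (clamp (2 * t))) q) (h (clamp (2 * t - 1)))).
{ intros t; unfold path_cat; destruct (Rle_dec _ _).
  - replace (clamp (2 * t - 1)) with 0.
    2: unfold clamp; rewrite Rmin_left, Rmax_left; lra.
    rewrite H0; set (w := g (clamp (2 * t))); apply injective_projections;
      [change (fst w = fst w + - fst q + fst q)|change (snd w = snd w + - snd q + snd q)]; ring.
  - replace (clamp (2 * t)) with 1.
    2: unfold clamp; rewrite Rmin_right, Rmax_right; lra.
    rewrite G1; set (w := h (clamp (2 * t - 1))); apply injective_projections;
      [change (fst w = fst q + - fst q + fst w)|change (snd w = snd q + - snd q + snd w)]; ring. }
repeat split.
- intros s; apply (continuous_ext _ _ _ (fun t => eq_sym (Ex t))).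
  apply (continuous_plus (V := prod_NormedModule _ R_NormedModule R_NormedModule)).
  + apply (continuous_minus (V := prod_NormedModule _ R_NormedModule R_NormedModule));
      [|apply continuous_const].
    apply (continuous_comp (fun t => clamp (2 * t)) g); [|apply Gc].
    apply (continuous_comp (fun t => 2 * t) clamp); [|apply continuous_clamp].
    apply (continuous_mult (fun _ => 2) (fun t => t)); [apply continuous_const|apply continuous_id].
  + apply (continuous_comp (fun t => clamp (2 * t - 1)) h); [|apply Hc].
    apply (continuous_comp (fun t => 2 * t - 1) clamp); [|apply continuous_clamp].
    apply (continuous_minus (fun t => 2 * t) (fun _ => 1)); [|apply continuous_const].
    apply (continuous_mult (fun _ => 2) (fun t => t)); [apply continuous_const|apply continuous_id].
- intros s; unfold path_cat; destruct (Rle_dec _ _); auto.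
- unfold path_cat; destruct (Rle_dec _ _); [|lra].
  rewrite clamp_id; [|split; lra]; rewrite Rmult_0_r; exact G0.
- unfold path_cat; destruct (Rle_dec _ _); [lra|].
  rewrite clamp_id; [|split; lra]; replace (2 * 1 - 1) with 1 by ring; exact H1.
Qed.

(** The first halving of [0,1] falls exactly where [path_cat] changes piece, so one level of depth
    is spent on separating [g] from [h]. *)
Lemma dyadic_sum_cat I n g h : g 1 = h 0 ->
  dyadic_sum I (S n) (path_cat g h) 0 1 = dyadic_sum I n g 0 1 + dyadic_sum I n h 0 1.
Proof.
intros E; simpl.
rewrite (dyadic_sum_reparam I n _ g 2 0 0 ((0 + 1) / 2)); [| lra |].
2:{ intros x Hx; unfold path_cat; destruct (Rle_dec _ _); [|lra].
    rewrite clamp_id; [f_equal; ring|split; lra]. }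
rewrite (dyadic_sum_reparam I n _ h 2 (-1) ((0 + 1) / 2) 1); [| lra |].
2:{ intros x Hx; unfold path_cat; destruct (Rle_dec _ _).
    (* At the junction [path_cat] still uses [g]; the hypothesis [g 1 = h 0] reconciles this with
       the formula for [h]. *)
    - replace x with (1 / 2) by lra.
      rewrite clamp_id; [|split; lra].
      replace (2 * (1 / 2)) with 1 by field; rewrite E; f_equal; field.
    - rewrite clamp_id; [f_equal; ring|split; lra]. }
f_equal; f_equal; field.
Qed.

(** Eventual constancy replaces a limit, since the sums of a local cocycle along a path
    stabilize. *)
Definition path_integral I (g : R -> R * R) (L : R) : Prop :=
  exists N, forall n, (N <= n)%nat -> dyadic_sum I n g 0 1 = L.

Lemma pow2_large d : 0 < d -> exists N, forall n, (N <= n)%nat -> 1 < d * 2 ^ n.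
Proof.
intros Hd; destruct (Pow_x_infinity 2) with (b := / d + 1) as [N HN].
{ rewrite Rabs_pos_eq; lra. }
exists N; intros n Hn; specialize (HN n Hn).
rewrite Rabs_pos_eq in HN by (apply pow_le; lra).
apply Rlt_le_trans with (d * (/ d + 1)); [|apply Rmult_le_compat_l; lra].
rewrite Rmult_plus_distr_l, Rinv_r; lra.
Qed.

Lemma path_integral_exists (U : R * R -> Prop) I g p q :
  open U -> local_cocycle U I -> path U g p q -> exists L, path_integral I g L.
Proof.
intros HU HI (Hc & Hg & _ & _); destruct (fine_exists U g HU Hg Hc) as [d Hd].
destruct (pow2_large d (proj1 Hd)) as [N HN].
exists (dyadic_sum I N g 0 1), N; intros n Hn; induction Hn as [|n Hn IH]; [reflexivity|].
rewrite (dyadic_sum_refine U I g d); auto; try lra.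
rewrite Rminus_0_r; apply HN, Hn.
Qed.

Lemma path_integral_unique I g L L' :
  path_integral I g L -> path_integral I g L' -> L = L'.
Proof.
intros [N HN] [N' HN']; rewrite <- (HN (N + N')%nat), <- (HN' (N + N')%nat); [reflexivity|lia|lia].
Qed.

Lemma path_integral_cat I g h L M : g 1 = h 0 ->
  path_integral I g L -> path_integral I h M -> path_integral I (path_cat g h) (L + M).
Proof.
intros E [N HN] [N' HN']; exists (S (N + N')); intros [|n] Hn; [lia|].
rewrite dyadic_sum_cat by exact E; rewrite HN, HN'; [reflexivity|lia|lia].
Qed.

Lemma path_integral_rev (U : R * R -> Prop) I g p q L : open U -> local_cocycle U I -> path U g p q ->
  path_integral I g L -> path_integral I (fun t => g (1 - t)) (- L).
Proof.
intros HU HI (Hc & Hg & _ & _) [N HN]; destruct (fine_exists U g HU Hg Hc) as [d Hd].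
destruct (pow2_large d (proj1 Hd)) as [N' HN'].
exists (N + N')%nat; intros n Hn.
rewrite (dyadic_sum_reparam I n _ g (-1) 1); [|lra|intros x _; f_equal; ring].
replace (-1 * 0 + 1) with 1 by ring; replace (-1 * 1 + 1) with 0 by ring.
rewrite (dyadic_sum_rev U I g d); auto; try lra.
- rewrite HN; [reflexivity|lia].
- rewrite Rminus_0_r; apply HN'; lia.
Qed.

(** The square identity is applied to the homotopy: one side of the square is [g], the other three
    are constant and contribute zero. *)
Lemma path_integral_null (U : R * R -> Prop) I g p : open U -> local_cocycle U I -> path U g p p ->
  null_homotopic U g -> path_integral I g 0.
Proof.
intros HU HI (_ & Hg & H0 & H1) (H & Hc & HHU & Hb & Ht & Hs).
(* Clamping both variables extends the homotopy to a continuous [U]-valued map on the whole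
   plane. *)
set (K := fun s t => H (clamp s, clamp t)).
assert (KU : forall s t, U (K s t)) by (intros; apply HHU; split; apply clamp_I01).
destruct (fine2_exists U K HU KU) as [d Hd].
{ intros q; apply (continuous_on_clamp I01sq H (fun q => (clamp (fst q), clamp (snd q)))).
  - exact Hc.
  - intros; split; apply clamp_I01.
  - apply (continuous_comp_2 (fun q : R * R => clamp (fst q)) (fun q => clamp (snd q)) pair).
    + apply (continuous_comp fst clamp); [apply continuous_fst|apply continuous_clamp].
    + apply (continuous_comp snd clamp); [apply continuous_snd|apply continuous_clamp].
    + apply (continuous_ext (fun x => x)); [intros []; reflexivity|apply continuous_id]. }
destruct (pow2_large d (proj1 Hd)) as [N HN].
exists N; intros n Hn.
assert (I0 : I01 0) by (split; lra); assert (I1 : I01 1) by (split; lra).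
assert (E := dyadic_sum_square U I K d n 0 1 0 1 HI Hd).
specialize (HN n Hn).
rewrite (dyadic_sum_reparam I n (fun x => K x 0) g 1 0) in E; [|lra|].
2:{ intros x Hx; unfold K; rewrite !clamp_id by (assumption || (split; lra)).
    rewrite Hb by exact Hx; f_equal; ring. }
rewrite (dyadic_sum_reparam I n (fun x => K x 1) (fun _ => p) 1 0) in E; [|lra|].
2:{ intros x Hx; unfold K; rewrite !clamp_id by (assumption || (split; lra)).
    rewrite Ht by exact Hx; exact H0. }
rewrite (dyadic_sum_reparam I n (fun y => K 1 y) (fun _ => p) 1 0) in E; [|lra|].
2:{ intros x Hx; unfold K; rewrite !clamp_id by (assumption || (split; lra)).
    rewrite (proj2 (Hs x Hx)); exact H0. }
rewrite (dyadic_sum_reparam I n (fun y => K 0 y) (fun _ => p) 1 0) in E; [|lra|].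
2:{ intros x Hx; unfold K; rewrite !clamp_id by (assumption || (split; lra)).
    rewrite (proj1 (Hs x Hx)); exact H0. }
assert (Up : U p) by (rewrite <- H0; apply Hg).
rewrite !(dyadic_sum_const U) in E by assumption.
replace (1 * 0 + 0) with 0 in E by ring; replace (1 * 1 + 0) with 1 in E by ring.
lra.
Qed.

(** [g] followed by [h] reversed is a loop with integral [L - M], and simple connectedness makes
    this integral zero. *)
Lemma path_integral_endpoints (U : R * R -> Prop) I g h p q L M :
  open U -> simply_connected U -> local_cocycle U I -> path U g p q -> path U h p q ->
  path_integral I g L -> path_integral I h M -> L = M.
Proof.
intros HU [_ Hsc] HI Hg Hh HL HM.
assert (Hl := path_cat_spec _ _ _ _ _ _ Hg (path_rev _ _ _ _ Hh)).
set (l := path_cat g (fun t => h (1 - t))) in *.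
assert (Z : path_integral I l 0).
{ apply (path_integral_null U I l p HU HI Hl), Hsc.
  - apply (path_in_of_path _ _ _ _ Hl).
  - destruct Hl as (_ & _ & -> & ->); reflexivity. }
assert (E := path_integral_unique I l (L + - M) 0); cut (L + - M = 0); [lra|].
apply E; [|exact Z].
apply path_integral_cat; [|exact HL|apply (path_integral_rev U I h p q); assumption].
destruct Hg as (_ & _ & _ & ->), Hh as (_ & _ & _ & Eh).
rewrite Rminus_0_r, Eh; reflexivity.
Qed.

(** The straight segment stays in the ball because each coordinate stays in an interval. *)
Lemma path_segment (U : R * R -> Prop) p r x y : (forall q, ball p r q -> U q) ->
  ball p r x -> ball p r y ->
  exists g : R -> R * R, path U g x y /\ forall s, ball p r (g s).
Proof.
intros HU [Hx1 Hx2] [Hy1 Hy2].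
change (Rabs (fst x - fst p) < r) in Hx1; change (Rabs (snd x - snd p) < r) in Hx2.
change (Rabs (fst y - fst p) < r) in Hy1; change (Rabs (snd y - snd p) < r) in Hy2.
set (g := fun t => (fst x + clamp t * (fst y - fst x), snd x + clamp t * (snd y - snd x))).
assert (Hb : forall s, ball p r (g s)).
{ intros s; destruct (clamp_I01 s) as [A B].
  assert (Hconv : forall k u v, Rabs (u - k) < r -> Rabs (v - k) < r ->
    Rabs (u + clamp s * (v - u) - k) < r).
  { intros k u v Hu Hv; apply Rabs_def2 in Hu, Hv.
    apply Rabs_def1; destruct (Rle_dec u v); nra. }
  split; apply Hconv; assumption. }
exists g; split; [|exact Hb]; repeat split.
- intros s.
  assert (C : forall k l : R, continuous (fun t => k + clamp t * l) s).
  { intros k l; apply (continuous_plus (fun _ => k)); [apply continuous_const|].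
    apply (continuous_mult clamp (fun _ => l)); [apply continuous_clamp|apply continuous_const]. }
  apply (continuous_comp_2 _ _ pair s (C _ _) (C _ _)).
  apply (continuous_ext (fun x => x)); [intros []; reflexivity|apply continuous_id].
- intros s; apply HU, Hb.
- unfold g; rewrite clamp_id by (split; lra); destruct x; simpl; f_equal; ring.
- unfold g; rewrite clamp_id by (split; lra); destruct x, y; simpl; f_equal; ring.
Qed.

Lemma dyadic_sum_in_ball (U : R * R -> Prop) I p r n g s t : local_cocycle U I ->
  (forall q, ball p r q -> U q) -> (forall x, ball p r (g x)) ->
  dyadic_sum I n g s t = I (g s) (g t).
Proof.
intros HI HU Hg; revert s t; induction n as [|n IH]; intros s t; simpl; [reflexivity|].
rewrite !IH; apply (HI p r); auto.
Qed.

(** [f q] is the integral from a base point [o] to [q] along a chosen path. Extending a path to [x]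
    by the segment to [y] adds [I x y], and path independence compares the result with [f y]. *)
Lemma local_cocycle_coboundary (U : R * R -> Prop) I :
  open U -> simply_connected U -> local_cocycle U I ->
  exists f : R * R -> R, forall p r x y, (forall q, ball p r q -> U q) ->
    ball p r x -> ball p r y -> I x y = f y - f x.
Proof.
intros HU Hsc HI.
destruct (classic (exists o, U o)) as [[o Ho]|K].
(* If [U] is empty, no ball contained in [U] contains a point, and any function will do. *)
2:{ exists (fun _ => 0); intros p r x y HB Hx; elim K; exists x; apply HB, Hx. }
(* The implication [U q] is placed under the existential so that choice produces a function on the
   whole plane. *)
assert (E : forall q, exists L, U q -> exists g, path U g o q /\ path_integral I g L).
{ intros q; destruct (classic (U q)) as [Hq|Hq]; [|exists 0; tauto].
  destruct (proj1 Hsc o q Ho Hq) as (g & Hg & E0 & E1).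
  apply path_of_path_in in Hg; rewrite E0, E1 in Hg.
  destruct (path_integral_exists U I _ o q HU HI Hg) as [L HL].
  exists L; intros _; eexists; split; eassumption. }
destruct (functional_choice _ E) as [f Hf]; exists f.
intros p r x y HB Hx Hy.
destruct (Hf x (HB x Hx)) as (g & Hg & Lg).
destruct (Hf y (HB y Hy)) as (h & Hh & Lh).
destruct (path_segment U p r x y HB Hx Hy) as (k & Hk & Bk).
assert (Lk : path_integral I k (I x y)).
{ exists 0%nat; intros n _; rewrite (dyadic_sum_in_ball U I p r) by assumption.
  destruct Hk as (_ & _ & -> & ->); reflexivity. }
assert (Hgk := path_cat_spec _ _ _ _ _ _ Hg Hk).
assert (Lgk : path_integral I (path_cat g k) (f x + I x y)).
{ apply path_integral_cat; try assumption.
  destruct Hg as (_ & _ & _ & ->), Hk as (_ & _ & -> & _); reflexivity. }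
assert (Q := path_integral_endpoints U I _ _ o y _ _ HU Hsc HI Hgk Hh Lgk Lh); lra.
Qed.

(** Along a path, [f] is locally constant in the parameter, so its derivative is zero and its values
    at the two ends agree. *)
Lemma locally_constant_path_connected (U : R * R -> Prop) (f : R * R -> R) :
  open U -> path_connected U ->
  (forall p r x y, (forall q, ball p r q -> U q) -> ball p r x -> ball p r y -> f x = f y) ->
  forall x y, U x -> U y -> f x = f y.
Proof.
intros HU Hpc Hf x y Hx Hy.
destruct (Hpc x y Hx Hy) as (g & Hg & E0 & E1).
apply path_of_path_in in Hg; rewrite E0, E1 in Hg.
set (h := fun t => g (clamp t)) in *; clearbody h.
destruct Hg as (Hc & Hh & <- & <-).
apply (eq_is_derive (fun t => f (h t))); [|lra].
intros t _; apply (is_derive_ext_loc (fun _ => f (h t))).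
2: apply (is_derive_const (f (h t))).
destruct (HU _ (Hh t)) as [e He].
assert (L := proj1 (filterlim_locally _ _) (Hc t) e); revert L.
apply filter_imp; intros s Hs.
apply (Hf (h t) e); [exact He|apply ball_center|exact Hs].
Qed.

(** * Smooth functions and the Poincare lemma *)

(** A finite order allows induction: partials of a function of order [S n] have order [n]. *)
Definition smooth2_upto (U : R * R -> Prop) (n : nat) (f : R -> R -> R) : Prop :=
  forall u v, U (u, v) -> ex_diff_n f n u v.

Lemma open_locally_2d (U : R * R -> Prop) (A : R -> R -> Prop) u v : open U ->
  (forall s t, U (s, t) -> A s t) -> U (u, v) -> locally_2d A u v.
Proof.
intros HU HA Huv; destruct (HU _ Huv) as [e He]; exists e; intros s t Hs Ht.
apply HA, He; split; assumption.
Qed.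

Lemma open_locally_u (U : R * R -> Prop) (A : R -> Prop) (u v : R) : open U ->
  (forall s, U (s, v) -> A s) -> U (u, v) -> locally u A.
Proof.
intros HU HA Huv; destruct (HU _ Huv) as [e He]; exists e; intros s Hs.
apply HA, He; split; [exact Hs|apply ball_center].
Qed.

(** The induction step of the regularity proofs below: explicit formulas [P] and [Q] may replace the
    partials, since they agree with them near every point of the open set [U]. *)
Lemma smooth2_upto_S (U : R * R -> Prop) n f P Q : open U ->
  (forall u v, U (u, v) -> continuity_2d_pt f u v) ->
  (forall u v, U (u, v) -> is_derive (fun s => f s v) u (P u v)) ->
  (forall u v, U (u, v) -> is_derive (fun t => f u t) v (Q u v)) ->
  smooth2_upto U n P -> smooth2_upto U n Q -> smooth2_upto U (S n) f.
Proof.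
intros HU Hc Hu Hv HP HQ u v Huv; simpl; repeat split.
- apply Hc, Huv.
- exists (P u v); apply Hu, Huv.
- exists (Q u v); apply Hv, Huv.
- apply (ex_diff_n_ext_loc P); [|apply HP, Huv].
  apply (open_locally_2d U); [exact HU| |exact Huv].
  intros s t Hst; symmetry; apply is_derive_unique, Hu, Hst.
- apply (ex_diff_n_ext_loc Q); [|apply HQ, Huv].
  apply (open_locally_2d U); [exact HU| |exact Huv].
  intros s t Hst; symmetry; apply is_derive_unique, Hv, Hst.
Qed.

Lemma smooth2_upto_le (U : R * R -> Prop) n m f : (m <= n)%nat -> smooth2_upto U n f -> smooth2_upto U m f.
Proof. intros Hm Hf u v Huv; apply (ex_diff_n_m n m Hm), Hf, Huv. Qed.

Lemma smooth2_upto_continuity (U : R * R -> Prop) n f u v : smooth2_upto U n f -> U (u, v) ->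
  continuity_2d_pt f u v.
Proof. intros Hf Huv; specialize (Hf u v Huv); destruct n; apply Hf. Qed.

Lemma smooth2_upto_Du (U : R * R -> Prop) n f : smooth2_upto U (S n) f -> smooth2_upto U n (Du f).
Proof. intros Hf u v Huv; apply ex_diff_n_deriv_aux1, Hf, Huv. Qed.

Lemma smooth2_upto_Dv (U : R * R -> Prop) n f : smooth2_upto U (S n) f -> smooth2_upto U n (Dv f).
Proof. intros Hf u v Huv; apply ex_diff_n_deriv_aux2, Hf, Huv. Qed.

Lemma smooth2_upto_is_Du (U : R * R -> Prop) n f u v : smooth2_upto U (S n) f -> U (u, v) ->
  is_derive (fun s => f s v) u (Du f u v).
Proof. intros Hf Huv; apply Derive_correct, (Hf u v Huv). Qed.

Lemma smooth2_upto_is_Dv (U : R * R -> Prop) n f u v : smooth2_upto U (S n) f -> U (u, v) ->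
  is_derive (fun t => f u t) v (Dv f u v).
Proof. intros Hf Huv; apply Derive_correct, (Hf u v Huv). Qed.

Lemma smooth2_upto_const (U : R * R -> Prop) n k : open U -> smooth2_upto U n (fun _ _ => k).
Proof.
intros HU; revert k; induction n as [|n IH]; intros k.
- intros u v _; split; [apply continuity_2d_pt_const|exact I].
- apply (smooth2_upto_S U n _ (fun _ _ => 0) (fun _ _ => 0)); auto.
  + intros; apply continuity_2d_pt_const.
  + intros u v _; apply (is_derive_const k).
  + intros u v _; apply (is_derive_const k).
Qed.

Lemma smooth2_upto_plus (U : R * R -> Prop) n f g : open U -> smooth2_upto U n f -> smooth2_upto U n g ->
  smooth2_upto U n (fun u v => f u v + g u v).
Proof.
intros HU; revert f g; induction n as [|n IH]; intros f g Hf Hg.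
- intros u v Huv; split; [|exact I].
  apply continuity_2d_pt_plus; eapply smooth2_upto_continuity; eassumption.
- apply (smooth2_upto_S U n _ (fun u v => Du f u v + Du g u v) (fun u v => Dv f u v + Dv g u v)); auto.
  + intros; apply continuity_2d_pt_plus; eapply smooth2_upto_continuity; eassumption.
  + intros u v Huv; apply (is_derive_plus (fun s => f s v) (fun s => g s v));
      eapply smooth2_upto_is_Du; eassumption.
  + intros u v Huv; apply (is_derive_plus (f u) (g u));
      eapply smooth2_upto_is_Dv; eassumption.
  + apply IH; apply smooth2_upto_Du; assumption.
  + apply IH; apply smooth2_upto_Dv; assumption.
Qed.

Lemma is_derive_mult_R (f g : R -> R) (x df dg : R) : is_derive f x df -> is_derive g x dg ->
  is_derive (fun t : R => f t * g t) x (df * g x + f x * dg).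
Proof. intros Hf Hg; apply (is_derive_mult f g x df dg Hf Hg Rmult_comm). Qed.

Lemma smooth2_upto_mult (U : R * R -> Prop) n f g : open U -> smooth2_upto U n f -> smooth2_upto U n g ->
  smooth2_upto U n (fun u v => f u v * g u v).
Proof.
intros HU; revert f g; induction n as [|n IH]; intros f g Hf Hg.
- intros u v Huv; split; [|exact I].
  apply continuity_2d_pt_mult; eapply smooth2_upto_continuity; eassumption.
(* The product rule multiplies a derivative of order [n] by an undifferentiated factor, whose order
   is lowered from [S n] to [n]. *)
- assert (Hf' := smooth2_upto_le U (S n) n f (le_S _ _ (le_n n)) Hf).
  assert (Hg' := smooth2_upto_le U (S n) n g (le_S _ _ (le_n n)) Hg).
  apply (smooth2_upto_S U n _ (fun u v => Du f u v * g u v + f u v * Du g u v)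
    (fun u v => Dv f u v * g u v + f u v * Dv g u v)); auto.
  + intros; apply continuity_2d_pt_mult; eapply smooth2_upto_continuity; eassumption.
  + intros u v Huv; apply (is_derive_mult_R (fun s => f s v) (fun s => g s v));
      eapply smooth2_upto_is_Du; eassumption.
  + intros u v Huv; apply (is_derive_mult_R (f u) (g u));
      eapply smooth2_upto_is_Dv; eassumption.
  + apply smooth2_upto_plus; auto; apply IH; auto; apply smooth2_upto_Du; assumption.
  + apply smooth2_upto_plus; auto; apply IH; auto; apply smooth2_upto_Dv; assumption.
Qed.

Lemma smooth2_const (U : R * R -> Prop) k : open U -> smooth2 U (fun _ _ => k).
Proof. intros HU u v Huv n; apply (smooth2_upto_const U n k HU u v Huv). Qed.

Lemma smooth2_plus (U : R * R -> Prop) f g : open U -> smooth2 U f -> smooth2 U g ->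
  smooth2 U (fun u v => f u v + g u v).
Proof.
intros HU Hf Hg u v Huv n; apply (smooth2_upto_plus U n f g HU); [| |exact Huv];
  intros s t Hst; auto.
Qed.

Lemma smooth2_mult (U : R * R -> Prop) f g : open U -> smooth2 U f -> smooth2 U g ->
  smooth2 U (fun u v => f u v * g u v).
Proof.
intros HU Hf Hg u v Huv n; apply (smooth2_upto_mult U n f g HU); [| |exact Huv];
  intros s t Hst; auto.
Qed.

Lemma smooth2_minus (U : R * R -> Prop) f g : open U -> smooth2 U f -> smooth2 U g ->
  smooth2 U (fun u v => f u v - g u v).
Proof.
intros HU Hf Hg u v Huv n.
apply (ex_diff_n_ext_loc (fun u v => f u v + (-1) * g u v)).
{ exists (mkposreal 1 Rlt_0_1); intros; ring. }
revert u v Huv n; change (smooth2 U (fun u v => f u v + -1 * g u v)).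
apply smooth2_plus; auto; apply smooth2_mult; auto; apply smooth2_const; auto.
Qed.

Lemma smooth2_Du (U : R * R -> Prop) f : smooth2 U f -> smooth2 U (Du f).
Proof. intros Hf u v Huv n; apply ex_diff_n_deriv_aux1, Hf, Huv. Qed.

Lemma smooth2_Dv (U : R * R -> Prop) f : smooth2 U f -> smooth2 U (Dv f).
Proof. intros Hf u v Huv n; apply ex_diff_n_deriv_aux2, Hf, Huv. Qed.

Lemma smooth2_is_Du (U : R * R -> Prop) f u v : smooth2 U f -> U (u, v) ->
  is_derive (fun s => f s v) u (Du f u v).
Proof. intros Hf Huv; apply Derive_correct, (Hf u v Huv 1%nat). Qed.

Lemma smooth2_is_Dv (U : R * R -> Prop) f u v : smooth2 U f -> U (u, v) ->
  is_derive (fun t => f u t) v (Dv f u v).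
Proof. intros Hf Huv; apply Derive_correct, (Hf u v Huv 1%nat). Qed.

Lemma smooth2_continuity (U : R * R -> Prop) f u v : smooth2 U f -> U (u, v) -> continuity_2d_pt f u v.
Proof. intros Hf Huv; apply (Hf u v Huv 0%nat). Qed.

Lemma continuity_2d_continuous_u (f : R -> R -> R) u v : continuity_2d_pt f u v -> continuous (fun s : R => f s v) u.
Proof.
intros H; apply continuity_2d_pt_filterlim in H.
apply (continuous_comp_2 (fun s => s) (fun _ => v) f u);
  [apply continuous_id|apply continuous_const|exact H].
Qed.

Lemma continuity_2d_continuous_v (f : R -> R -> R) u v : continuity_2d_pt f u v -> continuous (fun t : R => f u t) v.
Proof.
intros H; apply continuity_2d_pt_filterlim in H.
apply (continuous_comp_2 (fun _ => u) (fun t => t) f v);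
  [apply continuous_const|apply continuous_id|exact H].
Qed.

Lemma smooth2_of_partials (U : R * R -> Prop) f P Q : open U -> smooth2 U P -> smooth2 U Q ->
  (forall u v, U (u, v) -> is_derive (fun s => f s v) u (P u v)) ->
  (forall u v, U (u, v) -> is_derive (fun t => f u t) v (Q u v)) -> smooth2 U f.
Proof.
intros HU HP HQ Hu Hv.
(* Joint continuity comes from differentiability: the [u]-partial exists nearby and is continuous,
   and the [v]-partial exists at the point. *)
assert (Hc : forall u v, U (u, v) -> continuity_2d_pt f u v).
{ intros u v Huv; apply differentiable_continuity_pt.
  exists (P u v), (Q u v); apply filterdiff_differentiable_pt_lim.
  apply (is_derive_filterdiff f u v P (Q u v)); [|apply Hv, Huv|].
  - generalize (HU _ Huv); apply filter_imp; intros [s t] Hst; apply Hu, Hst.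
  - apply continuity_2d_pt_filterlim, (smooth2_continuity U); assumption. }
intros u v Huv [|n]; [split; [apply Hc, Huv|exact I]|].
apply (smooth2_upto_S U n f P Q HU Hc Hu Hv); [| |exact Huv]; intros s t Hst; auto.
Qed.

(** Each of the two functions appears in the derivative of the other, so one induction treats
    both. *)
Lemma smooth2_cos_sin (U : R * R -> Prop) f : open U -> smooth2 U f ->
  smooth2 U (fun u v => cos (f u v)) /\ smooth2 U (fun u v => sin (f u v)).
Proof.
intros HU Hf.
assert (HC : forall u v, U (u, v) -> continuity_2d_pt (fun u v => cos (f u v)) u v).
{ intros u v Huv; apply continuity_1d_2d_pt_comp; [apply continuity_cos|].
  apply (smooth2_continuity U); assumption. }
assert (HS : forall u v, U (u, v) -> continuity_2d_pt (fun u v => sin (f u v)) u v).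
{ intros u v Huv; apply continuity_1d_2d_pt_comp; [apply continuity_sin|].
  apply (smooth2_continuity U); assumption. }
assert (K : forall n, smooth2_upto U n (fun u v => cos (f u v)) /\
                      smooth2_upto U n (fun u v => sin (f u v))).
{ assert (Hu : forall n, smooth2_upto U n (Du f)).
  { intros n u v Huv; apply (smooth2_Du U f Hf u v Huv). }
  assert (Hv : forall n, smooth2_upto U n (Dv f)).
  { intros n u v Huv; apply (smooth2_Dv U f Hf u v Huv). }
  induction n as [|n [IHc IHs]].
  - split; intros u v Huv; (split; [auto|exact I]).
  - split.
    + apply (smooth2_upto_S U n _ (fun u v => (-1 * Du f u v) * sin (f u v))
        (fun u v => (-1 * Dv f u v) * sin (f u v))); auto.
      * intros u v Huv; replace (-1 * Du f u v * sin (f u v)) with (scal (Du f u v) (- sin (f u v)))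
          by (change (Du f u v * - sin (f u v) = -1 * Du f u v * sin (f u v)); ring).
        apply (is_derive_comp cos (fun s => f s v)); [apply is_derive_Reals, derivable_pt_lim_cos|].
        apply (smooth2_is_Du U); assumption.
      * intros u v Huv; replace (-1 * Dv f u v * sin (f u v)) with (scal (Dv f u v) (- sin (f u v)))
          by (change (Dv f u v * - sin (f u v) = -1 * Dv f u v * sin (f u v)); ring).
        apply (is_derive_comp cos (f u)); [apply is_derive_Reals, derivable_pt_lim_cos|].
        apply (smooth2_is_Dv U); assumption.
      * apply smooth2_upto_mult; auto; apply smooth2_upto_mult; auto; apply smooth2_upto_const; auto.
      * apply smooth2_upto_mult; auto; apply smooth2_upto_mult; auto; apply smooth2_upto_const; auto.
    + apply (smooth2_upto_S U n _ (fun u v => Du f u v * cos (f u v))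
        (fun u v => Dv f u v * cos (f u v))); auto.
      * intros u v Huv; apply (is_derive_comp sin (fun s => f s v));
          [apply is_derive_Reals, derivable_pt_lim_sin|].
        apply (smooth2_is_Du U); assumption.
      * intros u v Huv; apply (is_derive_comp sin (f u));
          [apply is_derive_Reals, derivable_pt_lim_sin|].
        apply (smooth2_is_Dv U); assumption.
      * apply smooth2_upto_mult; auto.
      * apply smooth2_upto_mult; auto. }
split; intros u v Huv n; apply (K n); exact Huv.
Qed.

(** * Primitives of closed 1-forms *)

Lemma between_ball a b c p r : Rmin a b <= c <= Rmax a b ->
  Rabs (a - p) < r -> Rabs (b - p) < r -> Rabs (c - p) < r.
Proof.
unfold Rmin, Rmax; intros H Ha Hb; apply Rabs_def2 in Ha, Hb; apply Rabs_def1;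
  destruct (Rle_dec a b); lra.
Qed.

Lemma locally_Rabs p r v : Rabs (v - p) < r -> locally v (fun t => Rabs (t - p) < r).
Proof.
intros H; assert (He : 0 < r - Rabs (v - p)) by lra.
exists (mkposreal _ He); intros t Ht; change (Rabs (t - v) < r - Rabs (v - p)) in Ht.
replace (t - p) with ((t - v) + (v - p)) by ring.
eapply Rle_lt_trans; [apply Rabs_triang|lra].
Qed.

(* The integral of P du + Q dv from x to y, first along u, then along v. *)
Definition form_integral (P Q : R -> R -> R) (x y : R * R) : R :=
  RInt (fun s => P s (snd x)) (fst x) (fst y) + RInt (fun t => Q (fst y) t) (snd x) (snd y).

(** The [v]-partial is the fundamental theorem of calculus. For the [u]-partial, differentiation
    under the integral gives the integral of [Du Q], that is of [Dv P], from [x2] to [v]; it turns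
    [P u x2] into [P u v]. *)
Lemma form_integral_partials (U : R * R -> Prop) P Q p r x u v :
  (forall u v, U (u, v) -> Dv P u v = Du Q u v) -> smooth2 U P -> smooth2 U Q ->
  (forall q, ball p r q -> U q) -> ball p r x -> ball p r (u, v) ->
  is_derive (fun s => form_integral P Q x (s, v)) u (P u v) /\
  is_derive (fun t => form_integral P Q x (u, t)) v (Q u v).
Proof.
intros Hcl HP HQ HB [Hx1 Hx2] [Hu Hv]; destruct p as [p1 p2], x as [x1 x2]; simpl in *.
change (Rabs (x1 - p1) < r) in Hx1; change (Rabs (x2 - p2) < r) in Hx2.
change (Rabs (u - p1) < r) in Hu; change (Rabs (v - p2) < r) in Hv.
assert (HU : forall s t, Rabs (s - p1) < r -> Rabs (t - p2) < r -> U (s, t)).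
{ intros s t Hs Ht; apply HB; split; assumption. }
assert (EQ : forall s t, Rabs (s - p1) < r -> Rabs (t - p2) < r ->
  ex_RInt (fun t => Q s t) x2 t).
{ intros s t Hs Ht; apply (ex_RInt_continuous (V := R_CompleteNormedModule)); intros z Hz.
  apply continuity_2d_continuous_v, (smooth2_continuity U); [exact HQ|].
  apply HU; [exact Hs|apply (between_ball x2 t); assumption]. }
assert (EP : forall s, Rabs (s - p1) < r -> ex_RInt (fun s => P s x2) x1 s).
{ intros s Hs; apply (ex_RInt_continuous (V := R_CompleteNormedModule)); intros z Hz.
  apply (continuity_2d_continuous_u P z x2), (smooth2_continuity U); [exact HP|].
  apply HU; [apply (between_ball x1 s); assumption|exact Hx2]. }
unfold form_integral; simpl; split.
- assert (D1 : is_derive (fun s => RInt (fun s => P s x2) x1 s) u (P u x2)).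
  { apply (is_derive_RInt (fun s => P s x2) _ x1).
    - generalize (locally_Rabs p1 r u Hu); apply filter_imp; intros s Hs.
      apply (RInt_correct (fun s => P s x2)), EP, Hs.
    - apply (continuity_2d_continuous_u P u x2), (smooth2_continuity U); [exact HP|].
      apply HU; assumption. }
  assert (D2 : is_derive (fun s => RInt (fun t => Q s t) x2 v) u
                 (RInt (fun t => Derive (fun s => Q s t) u) x2 v)).
  { apply (is_derive_RInt_param Q x2 v u).
    - generalize (locally_Rabs p1 r u Hu); apply filter_imp; intros s Hs t Ht.
      exists (Du Q s t); apply (smooth2_is_Du U); [exact HQ|].
      apply HU; [exact Hs|apply (between_ball x2 v); assumption].
    - intros t Ht; apply (smooth2_continuity U (Du Q)); [apply smooth2_Du, HQ|].
      apply HU; [exact Hu|apply (between_ball x2 v); assumption].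
    - generalize (locally_Rabs p1 r u Hu); apply filter_imp; intros s Hs; apply EQ; assumption. }
  replace (P u v) with (P u x2 + RInt (fun t => Derive (fun s => Q s t) u) x2 v).
  { apply (is_derive_plus _ _ u _ _ D1 D2). }
  assert (Hin : forall t, Rmin x2 v <= t <= Rmax x2 v -> U (u, t)).
  { intros t Ht; apply HU; [exact Hu|apply (between_ball x2 v); assumption]. }
  rewrite (RInt_ext _ (Derive (fun t => P u t))).
  2:{ intros t Ht; symmetry; apply (Hcl u t), Hin; lra. }
  rewrite RInt_Derive; [ring| |].
  + intros t Ht; eexists; apply (smooth2_is_Dv U P u t HP), Hin, Ht.
  + intros t Ht; apply (continuity_2d_continuous_v (Dv P)), (smooth2_continuity U);
      [apply smooth2_Dv, HP|apply Hin, Ht].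
- rewrite <- (Rplus_0_l (Q u v)); apply (is_derive_plus (fun _ => _) (fun t => RInt (Q u) x2 t)).
  + apply (is_derive_const (RInt (fun s => P s x2) x1 u)).
  + apply (is_derive_RInt (Q u) _ x2).
    * generalize (locally_Rabs p2 r v Hv); apply filter_imp; intros t Ht.
      apply (RInt_correct (Q u)), EQ; assumption.
    * apply continuity_2d_continuous_v, (smooth2_continuity U); [exact HQ|].
      apply HU; assumption.
Qed.

(** Inside the ball, [G] is a primitive of the form. The path from [y] to [z] with corner [(z1, y2)]
    then integrates to [G z - G y], one leg at a time. *)
Lemma closed_form_local_cocycle (U : R * R -> Prop) P Q : smooth2 U P -> smooth2 U Q ->
  (forall u v, U (u, v) -> Dv P u v = Du Q u v) -> local_cocycle U (form_integral P Q).
Proof.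
intros HP HQ Hcl p r x y z HB Hx Hy Hz.
set (G := form_integral P Q x).
assert (HG := fun u v => form_integral_partials U P Q p r x u v Hcl HP HQ HB Hx).
fold G in HG.
enough (form_integral P Q y z = G z - G y) by lra.
destruct p as [p1 p2], y as [y1 y2], z as [z1 z2], Hy as [Hy1 Hy2], Hz as [Hz1 Hz2].
simpl in *.
assert (HU : forall s t, Rabs (s - p1) < r -> Rabs (t - p2) < r -> U (s, t)).
{ intros s t Hs Ht; apply HB; split; assumption. }
unfold form_integral; simpl.
rewrite (is_RInt_unique (fun s => P s y2) y1 z1 (G (z1, y2) - G (y1, y2))).
2:{ apply (is_RInt_derive (fun s => G (s, y2)) (fun s => P s y2)).
    - intros s Hs; apply HG; split; [apply (between_ball y1 z1); assumption|exact Hy2].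
    - intros s Hs; apply (continuity_2d_continuous_u P s y2), (smooth2_continuity U); [exact HP|].
      apply HU; [apply (between_ball y1 z1); assumption|exact Hy2]. }
rewrite (is_RInt_unique (fun t => Q z1 t) y2 z2 (G (z1, z2) - G (z1, y2))); [ring|].
apply (is_RInt_derive (fun t => G (z1, t)) (fun t => Q z1 t)).
- intros s Hs; apply HG; split; [exact Hz1|apply (between_ball y2 z2); assumption].
- intros s Hs; apply (continuity_2d_continuous_v Q), (smooth2_continuity U); [exact HQ|].
  apply HU; [exact Hz1|apply (between_ball y2 z2); assumption].
Qed.

(** Near a point, the potential supplied by [local_cocycle_coboundary] is [form_integral] from that
    point plus a constant, so it inherits the partials. *)
Lemma poincare_simply_connected (U : R * R -> Prop) P Q :
  open U -> simply_connected U -> smooth2 U P -> smooth2 U Q ->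
  (forall u v, U (u, v) -> Dv P u v = Du Q u v) ->
  exists f : R -> R -> R, smooth2 U f /\
    (forall u v, U (u, v) -> is_derive (fun s => f s v) u (P u v)) /\
    (forall u v, U (u, v) -> is_derive (fun t => f u t) v (Q u v)).
Proof.
intros HU Hsc HP HQ Hcl.
destruct (local_cocycle_coboundary U _ HU Hsc (closed_form_local_cocycle U P Q HP HQ Hcl))
  as [f Hf].
exists (fun u v => f (u, v)).
assert (K : forall u v, U (u, v) -> is_derive (fun s => f (s, v)) u (P u v) /\
                                    is_derive (fun t => f (u, t)) v (Q u v)).
{ intros u v Huv; destruct (HU _ Huv) as [e He].
  assert (C : ball (u, v) e (u, v)) by apply ball_center.
  destruct (form_integral_partials U P Q (u, v) e (u, v) u v Hcl HP HQ He C C) as [Gu Gv].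
  split.
  - apply (is_derive_ext_loc (fun s => form_integral P Q (u, v) (s, v) + f (u, v))).
    + exists e; intros s Hs; pose (s0 := s : R).
      change (form_integral P Q (u, v) (s0, v) + f (u, v) = f (s0, v)).
      rewrite (Hf (u, v) e (u, v) (s0, v) He C); [ring|].
      split; [exact Hs|apply ball_center].
    + rewrite <- (Rplus_0_r (P u v)); apply (is_derive_plus _ (fun _ => f (u, v))); [exact Gu|].
      apply (is_derive_const (f (u, v))).
  - apply (is_derive_ext_loc (fun t => form_integral P Q (u, v) (u, t) + f (u, v))).
    + exists e; intros s Hs; pose (s0 := s : R).
      change (form_integral P Q (u, v) (u, s0) + f (u, v) = f (u, s0)).
      rewrite (Hf (u, v) e (u, v) (u, s0) He C); [ring|].
      split; [apply ball_center|exact Hs].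
    + rewrite <- (Rplus_0_r (Q u v)); apply (is_derive_plus _ (fun _ => f (u, v))); [exact Gv|].
      apply (is_derive_const (f (u, v))). }
split; [|split; intros; apply K; assumption].
apply (smooth2_of_partials U _ P Q); try assumption; intros; apply K; assumption.
Qed.

Lemma eq_is_derive_between (f : R -> R) (s t : R) :
  (forall x, Rmin s t <= x <= Rmax s t -> is_derive f x 0) -> f s = f t.
Proof.
intros Hf; destruct (Rtotal_order s t) as [L|[->|L]]; [|reflexivity|symmetry];
  apply eq_is_derive; try exact L; intros x Hx; apply Hf.
- rewrite Rmin_left, Rmax_right; lra.
- rewrite Rmin_right, Rmax_left; lra.
Qed.

Lemma zero_gradient_constant (U : R * R -> Prop) (f : R -> R -> R) :
  open U -> path_connected U ->
  (forall u v, U (u, v) -> is_derive (fun s => f s v) u 0) ->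
  (forall u v, U (u, v) -> is_derive (fun t => f u t) v 0) ->
  forall u v u' v', U (u, v) -> U (u', v') -> f u v = f u' v'.
Proof.
intros HU Hpc Hu Hv u v u' v' H H'.
refine (locally_constant_path_connected U (fun q => f (fst q) (snd q)) HU Hpc _ (u, v) (u', v') H H').
intros [p1 p2] r [x1 x2] [y1 y2] HB [Hx1 Hx2] [Hy1 Hy2]; simpl in *.
(* The corner of an axis-parallel path, which lies in the ball because balls are squares. *)
transitivity (f y1 x2).
- apply (eq_is_derive_between (fun s => f s x2)); intros s Hs; apply Hu, HB; split; [|exact Hx2].
  apply (between_ball x1 y1); assumption.
- apply (eq_is_derive_between (f y1)); intros t Ht; apply Hv, HB; split; [exact Hy1|].
  apply (between_ball x2 y2); assumption.
Qed.

Lemma is_derive_plus_R (f g : R -> R) (x df dg : R) : is_derive f x df -> is_derive g x dg ->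
  is_derive (fun t : R => f t + g t) x (df + dg).
Proof. apply (is_derive_plus f g x df dg). Qed.

Lemma is_derive_minus_R (f g : R -> R) (x df dg : R) : is_derive f x df -> is_derive g x dg ->
  is_derive (fun t : R => f t - g t) x (df - dg).
Proof. apply (is_derive_minus f g x df dg). Qed.

Lemma is_derive_const_R (k x : R) : is_derive (fun _ : R => k) x 0.
Proof. apply (is_derive_const k). Qed.

Lemma is_derive_eq (f : R -> R) (x l l' : R) : is_derive f x l -> l = l' -> is_derive f x l'.
Proof. intros H <-; exact H. Qed.

(** Computes a derivative by the sum, difference and product rules from the derivatives in the
    context, and leaves its equality with the expected value as the goal. *)
Ltac derive_arith :=
  eapply is_derive_eq;
  [cbv beta; repeat match goal with
   | |- is_derive (fun t => @?f t + @?g t) _ _ => apply (is_derive_plus_R f g)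
   | |- is_derive (fun t => @?f t - @?g t) _ _ => apply (is_derive_minus_R f g)
   | |- is_derive (fun t => @?f t * @?g t) _ _ => apply (is_derive_mult_R f g)
   | |- is_derive (fun _ => ?k) _ _ => apply is_derive_const_R
   | |- _ => eassumption
   end|].

Lemma smooth2_Schwarz (U : R * R -> Prop) (f : R -> R -> R) (u v : R) : open U -> smooth2 U f -> U (u, v) ->
  Dv (Du f) u v = Du (Dv f) u v.
Proof.
intros HU Hf Huv; symmetry; apply (Schwarz f u v).
- apply (open_locally_2d U); [exact HU| |exact Huv]; intros s t Hst; repeat split; eexists.
  + apply (smooth2_is_Du U f); assumption.
  + apply (smooth2_is_Dv U f); assumption.
  + apply (smooth2_is_Du U (Dv f)); [apply smooth2_Dv|]; assumption.
  + apply (smooth2_is_Dv U (Du f)); [apply smooth2_Du|]; assumption.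
- apply (smooth2_continuity U (Du (Dv f))); [apply smooth2_Du, smooth2_Dv|]; assumption.
- apply (smooth2_continuity U (Dv (Du f))); [apply smooth2_Dv, smooth2_Du|]; assumption.
Qed.

Lemma Du_ext (U : R * R -> Prop) (f g : R -> R -> R) (u v : R) : open U ->
  (forall u v, U (u, v) -> f u v = g u v) -> U (u, v) -> Du f u v = Du g u v.
Proof.
intros HU E Huv; apply Derive_ext_loc, (open_locally_u U _ u v); auto.
Qed.

(** * Normal p-minimal surfaces *)

Lemma J0E (p v : H1) : J0 p v = (- cy v, cx v, - cx p * cx v - cy p * cy v).
Proof.
apply H1_eq;
  [change (cx v * 0 + - (cy v * 1) = - cy v)
  |change (cx v * 1 + - (cy v * 0) = cx v)
  |change (cx v * - cx p + - (cy v * cy p) = - cx p * cx v - cy p * cy v)]; ring.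
Qed.

Lemma theta0_J0 (p v : H1) : theta0 p (J0 p v) = 0.
Proof. rewrite J0E; unfold theta0, cx, cy, cz; simpl; ring. Qed.

(** [J0] produces no [T] component, so only the determinant of the planar parts remains. The
    formulas for [b], [l] and [m] come from here. *)
Lemma metric_J0 (p v w : H1) : metric p v (J0 p w) = cy v * cx w - cx v * cy w.
Proof.
unfold metric; rewrite theta0_J0, J0E.
change (cx (- cy w, cx w, _)) with (- cy w); change (cy (- cy w, cx w, _)) with (cx w); ring.
Qed.

Lemma metric_eT (p v : H1) : metric p v (eT p) = theta0 p v.
Proof. unfold metric, theta0, eT, cx, cy, cz; simpl; ring. Qed.

(* The structure equations of a normal p-minimal surface, for
   F = (x, y, z) and F_u = (p, q, r). *)
Definition structure_eqs (x y z p q r a b c : R -> R -> R) (u v : R) : Prop :=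
  p u v * p u v + q u v * q u v = 1 /\
  r u v = y u v * p u v - x u v * q u v /\
  is_derive (fun s => x s v) u (p u v) /\
  is_derive (fun s => y s v) u (q u v) /\
  is_derive (fun s => z s v) u (r u v) /\
  is_derive (fun t => x u t) v (a u v * p u v - b u v * q u v) /\
  is_derive (fun t => y u t) v (a u v * q u v + b u v * p u v) /\
  is_derive (fun t => z u t) v
    (y u v * (a u v * p u v - b u v * q u v) - x u v * (a u v * q u v + b u v * p u v) + c u v) /\
  is_derive (fun s => p s v) u 0 /\
  is_derive (fun s => q s v) u 0 /\
  is_derive (fun t => p u t) v (- Du b u v * q u v) /\
  is_derive (fun t => q u t) v (Du b u v * p u v).

Lemma normal_pminimal_structure (U : R * R -> Prop) (F : R -> R -> H1) (a b c : R -> R -> R) :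
  open U -> smooth2 U a -> smooth2 U b -> (forall u v, U (u, v) -> Du a u v = 0) ->
  normal_pminimal U F -> has_first_coefs U F a b c -> forall u v, U (u, v) ->
  structure_eqs (fun u v => cx (F u v)) (fun u v => cy (F u v)) (fun u v => cz (F u v))
    (fun u v => cx (DFu F u v)) (fun u v => cy (DFu F u v)) (fun u v => cz (DFu F u v))
    a b c u v.
Proof.
intros HU Ha Hb Hau [[(Sx & Sy & Sz) (_ & Hchar & Hnorm)] Hl] Hco.
set (x := fun u v => cx (F u v)) in *.
set (y := fun u v => cy (F u v)) in *.
set (z := fun u v => cz (F u v)) in *.
set (p := fun u v => cx (DFu F u v)).
set (q := fun u v => cy (DFu F u v)).
set (r := fun u v => cz (DFu F u v)).
assert (Sp : smooth2 U p) by apply (smooth2_Du U x Sx).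
assert (Sq : smooth2 U q) by apply (smooth2_Du U y Sy).
assert (Hth : forall u v, U (u, v) -> theta0 (F u v) (DFu F u v) = 0).
{ intros u v Huv; apply (proj2 (Hchar u v Huv (DFu F u v))).
  exists 1; symmetry; apply (scal_one (DFu F u v)). }
assert (Hpq : forall u v, U (u, v) -> p u v * p u v + q u v * q u v = 1).
{ intros u v Huv; specialize (Hnorm u v Huv); unfold metric in Hnorm.
  rewrite (Hth u v Huv) in Hnorm; fold (p u v) (q u v) in Hnorm.
  apply (f_equal Rsqr) in Hnorm; rewrite Rsqr_sqrt in Hnorm by nra.
  unfold Rsqr in Hnorm; lra. }
(* [a] and [b] are the components of [(x_v, y_v)] in the orthonormal basis [(p, q)], [(-q, p)];
   inverting this rotation gives [x_v] and [y_v]. The contact form on [F_v] is [c], which gives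
   [z_v]. *)
assert (Hxyz : forall u v, U (u, v) -> Dv x u v = a u v * p u v - b u v * q u v /\
   Dv y u v = a u v * q u v + b u v * p u v /\
   Dv z u v = c u v + y u v * Dv x u v - x u v * Dv y u v).
{ intros u v Huv; destruct (Hco u v Huv) as (Ea & Eb & Ec).
  unfold coef_c in Ec; rewrite metric_eT in Ec.
  unfold coef_b, frameY in Eb; rewrite metric_J0 in Eb.
  unfold coef_a, metric, frameX in Ea; rewrite (Hth u v Huv) in Ea.
  change (Dv z u v + x u v * Dv y u v - y u v * Dv x u v = c u v) in Ec.
  change (Dv y u v * p u v - Dv x u v * q u v = b u v) in Eb.
  change (Dv x u v * p u v + Dv y u v * q u v + theta0 (F u v) (DFv F u v) * 0 = a u v) in Ea.
  rewrite Rmult_0_r, Rplus_0_r in Ea.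
  specialize (Hpq u v Huv); rewrite <- Ea, <- Eb, <- Ec.
  repeat split; [| |ring].
  - transitivity (Dv x u v * (p u v * p u v + q u v * q u v)); [rewrite Hpq|]; ring.
  - transitivity (Dv y u v * (p u v * p u v + q u v * q u v)); [rewrite Hpq|]; ring. }
assert (Hcurv : forall u v, U (u, v) -> Du q u v * p u v - Du p u v * q u v = 0).
{ intros u v Huv; rewrite <- (Hl u v Huv); symmetry; apply metric_J0. }
assert (Hr : forall u v, U (u, v) -> r u v = y u v * p u v - x u v * q u v).
{ intros u v Huv; generalize (Hth u v Huv); unfold theta0.
  fold (x u v) (y u v) (p u v) (q u v) (r u v); lra. }
assert (Exu : Du x = p) by reflexivity.
assert (Eyu : Du y = q) by reflexivity.
assert (Ezu : Du z = r) by reflexivity.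
clearbody x y z p q r; clear Hchar Hnorm Hl Hco Hth F.
(* The derivative of [p^2 + q^2 = 1] makes [(p_u, q_u)] orthogonal to [(p, q)], and [l = 0] makes it
   parallel to [(p, q)]. *)
assert (Hpu : forall u v, U (u, v) -> Du p u v = 0 /\ Du q u v = 0).
{ intros u v Huv; assert (Hl := Hcurv u v Huv).
  assert (Dp := smooth2_is_Du U p u v Sp Huv); assert (Dq := smooth2_is_Du U q u v Sq Huv).
  assert (E : Du (fun u v => p u v * p u v + q u v * q u v) u v = 0).
  { rewrite (Du_ext U _ (fun _ _ => 1) u v HU Hpq Huv); apply (Derive_const 1 u). }
  assert (E' : Du (fun u v => p u v * p u v + q u v * q u v) u v =
    Du p u v * p u v + p u v * Du p u v + (Du q u v * q u v + q u v * Du q u v)).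
  { apply is_derive_unique; derive_arith; reflexivity. }
  rewrite E in E'; specialize (Hpq u v Huv); split.
  - transitivity (Du p u v * (p u v * p u v + q u v * q u v)); [rewrite Hpq; ring|].
    transitivity (p u v * (Du p u v * p u v + q u v * Du q u v)
      - q u v * (Du q u v * p u v - Du p u v * q u v)); [ring|].
    rewrite Hl; replace (Du p u v * p u v + q u v * Du q u v) with 0 by lra; ring.
  - transitivity (Du q u v * (p u v * p u v + q u v * q u v)); [rewrite Hpq; ring|].
    transitivity (q u v * (Du p u v * p u v + q u v * Du q u v)
      + p u v * (Du q u v * p u v - Du p u v * q u v)); [ring|].
    rewrite Hl; replace (Du p u v * p u v + q u v * Du q u v) with 0 by lra; ring. }
(* As [p = x_u], one has [p_v = (x_v)_u = (a p - b q)_u], where only [b] depends on [u]; likewise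
   for [q]. *)
assert (Hpv : forall u v, U (u, v) -> Dv p u v = - Du b u v * q u v /\ Dv q u v = Du b u v * p u v).
{ intros u v Huv.
  assert (Da := smooth2_is_Du U a u v Ha Huv); rewrite (Hau u v Huv) in Da.
  assert (Db := smooth2_is_Du U b u v Hb Huv).
  assert (Dp := smooth2_is_Du U p u v Sp Huv); assert (Dq := smooth2_is_Du U q u v Sq Huv).
  destruct (Hpu u v Huv) as [Ep Eq]; rewrite Ep in Dp; rewrite Eq in Dq.
  split.
  - rewrite <- Exu at 1; rewrite (smooth2_Schwarz U x u v HU Sx Huv).
    rewrite (Du_ext U _ (fun u v => a u v * p u v - b u v * q u v) u v HU (fun u v H => proj1 (Hxyz u v H)) Huv).
    apply is_derive_unique; derive_arith; ring.
  - rewrite <- Eyu at 1; rewrite (smooth2_Schwarz U y u v HU Sy Huv).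
    rewrite (Du_ext U _ (fun u v => a u v * q u v + b u v * p u v) u v HU (fun u v H => proj1 (proj2 (Hxyz u v H))) Huv).
    apply is_derive_unique; derive_arith; ring. }
intros u v Huv; unfold structure_eqs.
destruct (Hxyz u v Huv) as (Ex & Ey & Ez), (Hpu u v Huv) as (Epu & Equ), (Hpv u v Huv) as (Epv & Eqv).
split; [apply Hpq, Huv|]; split; [apply Hr, Huv|].
split; [rewrite <- Exu; apply (smooth2_is_Du U x); assumption|].
split; [rewrite <- Eyu; apply (smooth2_is_Du U y); assumption|].
split; [rewrite <- Ezu; apply (smooth2_is_Du U z); assumption|].
split; [eapply is_derive_eq; [apply (smooth2_is_Dv U x); assumption|exact Ex]|].
split; [eapply is_derive_eq; [apply (smooth2_is_Dv U y); assumption|exact Ey]|].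
split.
{ eapply is_derive_eq; [apply (smooth2_is_Dv U z); assumption|].
  rewrite Ez, Ex, Ey; ring. }
split; [eapply is_derive_eq; [apply (smooth2_is_Du U p); assumption|exact Epu]|].
split; [eapply is_derive_eq; [apply (smooth2_is_Du U q); assumption|exact Equ]|].
split; eapply is_derive_eq;
  [apply (smooth2_is_Dv U p); assumption|exact Epv|apply (smooth2_is_Dv U q); assumption|exact Eqv].
Qed.

(** The contact form is 0 on [F_u] and [c] on [F_v]. As [c] never vanishes, [s F_u + t F_v] is a
    contact vector only for [t = 0]; regularity, absence of singular points and the characteristic
    direction all follow. *)
Lemma normal_of_structure (U : R * R -> Prop) (x y z p q r a b c : R -> R -> R) :
  open U -> smooth2 U x -> smooth2 U y -> smooth2 U z ->
  (forall u v, U (u, v) -> c u v <> 0) ->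
  (forall u v, U (u, v) -> structure_eqs x y z p q r a b c u v) ->
  normal_pminimal U (fun u v => (x u v, y u v, z u v)) /\
  has_first_coefs U (fun u v => (x u v, y u v, z u v)) a b c.
Proof.
intros HU Sx Sy Sz Hc Hst.
set (F := fun u v => (x u v, y u v, z u v)).
assert (HF : forall u v, U (u, v) -> DFu F u v = (p u v, q u v, r u v) /\
  DFv F u v = (a u v * p u v - b u v * q u v, a u v * q u v + b u v * p u v,
   y u v * (a u v * p u v - b u v * q u v) - x u v * (a u v * q u v + b u v * p u v) + c u v)).
{ intros u v Huv; destruct (Hst u v Huv) as (_ & _ & Xu & Yu & Zu & Xv & Yv & Zv & _).
  split; apply H1_eq; apply is_derive_unique; assumption. }
assert (Hu : forall u v, U (u, v) -> theta0 (F u v) (DFu F u v) = 0).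
{ intros u v Huv; rewrite (proj1 (HF u v Huv)); destruct (Hst u v Huv) as (_ & Er & _).
  unfold theta0, cx, cy, cz; simpl; rewrite Er; ring. }
assert (Hv : forall u v, U (u, v) -> theta0 (F u v) (DFv F u v) = c u v).
{ intros u v Huv; rewrite (proj2 (HF u v Huv)); unfold theta0, cx, cy, cz; simpl; ring. }
assert (Hlin : forall P s t w w', theta0 P (plus (scal s w) (scal t w')) =
   s * theta0 P w + t * theta0 P w').
{ intros P s t w w'; unfold theta0.
  change (s * cz w + t * cz w' + cx P * (s * cy w + t * cy w') - cy P * (s * cx w + t * cx w') =
    s * (cz w + cx P * cy w - cy P * cx w) + t * (cz w' + cx P * cy w' - cy P * cx w')); ring. }
assert (Hnorm : forall u v, U (u, v) -> cx (DFu F u v) * cx (DFu F u v) + cy (DFu F u v) * cy (DFu F u v) = 1).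
{ intros u v Huv; rewrite (proj1 (HF u v Huv)); apply (Hst u v Huv). }
assert (Hs0 : forall w w' : H1, plus (scal 0 w) (scal 1 w') = w').
{ intros w w'; apply H1_eq;
    [change (0 * cx w + 1 * cx w' = cx w')
    |change (0 * cy w + 1 * cy w' = cy w')
    |change (0 * cz w + 1 * cz w' = cz w')]; ring. }
assert (Ht0 : forall s (w w' : H1), plus (scal s w) (scal 0 w') = scal s w).
{ intros s w w'; apply H1_eq;
    [change (s * cx w + 0 * cx w' = s * cx w)
    |change (s * cy w + 0 * cy w' = s * cy w)
    |change (s * cz w + 0 * cz w' = s * cz w)]; ring. }
split; [split|].
- split; [repeat split; assumption|]; split; [|split].
  + intros u v Huv; split.
    * intros s t E.
      assert (E' := f_equal (theta0 (F u v)) E); rewrite Hlin, Hu, Hv in E' by exact Huv.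
      unfold theta0 in E'; change (s * 0 + t * c u v = 0 + x u v * 0 - y u v * 0) in E'.
      assert (Et : t = 0).
      { apply Rmult_eq_reg_r with (c u v); [lra|apply Hc, Huv]. }
      subst t; split; [|reflexivity]; rewrite Ht0 in E.
      assert (Ep := f_equal cx E); assert (Eq := f_equal cy E).
      change (s * cx (DFu F u v) = 0) in Ep; change (s * cy (DFu F u v) = 0) in Eq.
      specialize (Hnorm u v Huv).
      transitivity (s * (cx (DFu F u v) * cx (DFu F u v) + cy (DFu F u v) * cy (DFu F u v)));
        [rewrite Hnorm; ring|].
      transitivity ((s * cx (DFu F u v)) * cx (DFu F u v) + (s * cy (DFu F u v)) * cy (DFu F u v));
        [ring|rewrite Ep, Eq; ring].
    * intros Hsing; apply (Hc u v Huv); rewrite <- Hv by exact Huv.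
      apply Hsing; exists 0, 1; symmetry; apply Hs0.
  + intros u v Huv w; split.
    * intros [[s [t ->]] Hcon]; unfold contact in Hcon.
      rewrite Hlin, Hu, Hv in Hcon by exact Huv.
      assert (Et : t = 0).
      { apply Rmult_eq_reg_r with (c u v); [lra|apply Hc, Huv]. }
      subst t; exists s; apply Ht0.
    * intros [s ->]; split; [exists s, 0; symmetry; apply Ht0|].
      unfold contact; rewrite <- (Ht0 s _ (DFu F u v)), Hlin, Hu by exact Huv; ring.
  + intros u v Huv; unfold metric; rewrite Hu, Hnorm by exact Huv.
    rewrite Rmult_0_r, Rplus_0_r; apply sqrt_1.
- intros u v Huv; unfold coef_l, frameY; rewrite metric_J0.
  destruct (Hst u v Huv) as (_ & _ & _ & _ & _ & _ & _ & _ & Pu & Qu & _).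
  change (Du (fun s t => cy (DFu F s t)) u v * cx (DFu F u v)
    - Du (fun s t => cx (DFu F s t)) u v * cy (DFu F u v) = 0).
  rewrite (Du_ext U (fun s t => cy (DFu F s t)) q u v HU), (Du_ext U (fun s t => cx (DFu F s t)) p u v HU);
    try exact Huv; try (intros s t H; rewrite (proj1 (HF s t H)); reflexivity).
  rewrite (is_derive_unique _ _ _ Pu : Du p u v = 0), (is_derive_unique _ _ _ Qu : Du q u v = 0); ring.
- intros u v Huv; destruct (HF u v Huv) as [Fu Fv]; destruct (Hst u v Huv) as (N & _).
  unfold coef_a, coef_b, coef_c, frameY, frameX; rewrite metric_J0, metric_eT, Hv by exact Huv.
  unfold metric; rewrite Hu, Fu, Fv by exact Huv; unfold cx, cy; simpl.
  repeat split.
  + transitivity (a u v * (p u v * p u v + q u v * q u v)); [ring|rewrite N; ring].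
  + transitivity (b u v * (p u v * p u v + q u v * q u v)); [ring|rewrite N; ring].
Qed.

(** * Existence by successive integration *)

Lemma normal_pminimal_exists (U : R * R -> Prop) (a b c : R -> R -> R) :
  open U -> simply_connected U -> smooth2 U a -> smooth2 U b -> smooth2 U c ->
  (forall u v, U (u, v) -> c u v <> 0) ->
  (forall u v, U (u, v) -> Du a u v = 0) ->
  (forall u v, U (u, v) -> Du (Du b) u v = 0) ->
  (forall u v, U (u, v) -> Du c u v = 2 * b u v) ->
  exists F, normal_pminimal U F /\ has_first_coefs U F a b c.
Proof.
intros HU Hsc Sa Sb Sc Hc Ha Hb Hcu.
(* The angle [th] integrates [b_u dv], a form that is closed because [b_uu = 0]. *)
destruct (poincare_simply_connected U (fun _ _ => 0) (Du b) HU Hsc) as (th & Sth & Tu & Tv).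
{ apply smooth2_const, HU. } { apply smooth2_Du, Sb. }
{ intros u v Huv; rewrite Hb by exact Huv; apply (Derive_const 0 v). }
destruct (smooth2_cos_sin U th HU Sth) as [SC SS].
set (C := fun u v => cos (th u v)) in *; set (S := fun u v => sin (th u v)) in *.
assert (HCS : forall u v, U (u, v) -> is_derive (fun s => C s v) u 0 /\ is_derive (fun s => S s v) u 0 /\
  is_derive (fun t => C u t) v (- Du b u v * S u v) /\ is_derive (fun t => S u t) v (Du b u v * C u v)).
{ intros u v Huv; split; [|split; [|split]].
  - eapply is_derive_eq; [apply (is_derive_comp cos (fun s => th s v));
      [apply is_derive_Reals, derivable_pt_lim_cos|apply Tu, Huv]|].
    change (0 * - sin (th u v) = 0); ring.
  - eapply is_derive_eq; [apply (is_derive_comp sin (fun s => th s v));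
      [apply is_derive_Reals, derivable_pt_lim_sin|apply Tu, Huv]|].
    change (0 * cos (th u v) = 0); ring.
  - eapply is_derive_eq; [apply (is_derive_comp cos (th u));
      [apply is_derive_Reals, derivable_pt_lim_cos|apply Tv, Huv]|].
    change (Du b u v * - sin (th u v) = - Du b u v * S u v); unfold S; ring.
  - eapply is_derive_eq; [apply (is_derive_comp sin (th u));
      [apply is_derive_Reals, derivable_pt_lim_sin|apply Tv, Huv]|].
    reflexivity. }
assert (HN : forall u v, C u v * C u v + S u v * S u v = 1).
{ intros u v; unfold C, S; generalize (sin2_cos2 (th u v)); unfold Rsqr; lra. }
clearbody C S.
assert (Da : forall u v, U (u, v) -> is_derive (fun s => a s v) u 0).
{ intros u v Huv; rewrite <- (Ha u v Huv); apply (smooth2_is_Du U a); assumption. }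
assert (Db : forall u v, U (u, v) -> is_derive (fun s => b s v) u (Du b u v)).
{ intros u v Huv; apply (smooth2_is_Du U b); assumption. }
assert (Dc : forall u v, U (u, v) -> is_derive (fun s => c s v) u (2 * b u v)).
{ intros u v Huv; rewrite <- (Hcu u v Huv); apply (smooth2_is_Du U c); assumption. }
(* [X] and [Y] are the prescribed [x_v] and [y_v]. Since [a_u = 0], their [u]-derivatives equal
   [C_v] and [S_v]. *)
set (X := fun u v => a u v * C u v - b u v * S u v).
set (Y := fun u v => a u v * S u v + b u v * C u v).
assert (SX : smooth2 U X).
{ apply smooth2_minus; [exact HU| |]; apply smooth2_mult; assumption. }
assert (SY : smooth2 U Y).
{ apply smooth2_plus; [exact HU| |]; apply smooth2_mult; assumption. }
assert (DX : forall u v, U (u, v) -> is_derive (fun s => X s v) u (- Du b u v * S u v)).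
{ intros u v Huv; destruct (HCS u v Huv) as (C1 & S1 & _).
  specialize (Da u v Huv); specialize (Db u v Huv).
  unfold X; derive_arith; ring. }
assert (DY : forall u v, U (u, v) -> is_derive (fun s => Y s v) u (Du b u v * C u v)).
{ intros u v Huv; destruct (HCS u v Huv) as (C1 & S1 & _).
  specialize (Da u v Huv); specialize (Db u v Huv).
  unfold Y; derive_arith; ring. }
destruct (poincare_simply_connected U C X HU Hsc SC SX) as (x & Sx & xu & xv).
{ intros u v Huv; rewrite (is_derive_unique _ _ _ (DX u v Huv) : Du X u v = _).
  apply is_derive_unique, HCS, Huv. }
destruct (poincare_simply_connected U S Y HU Hsc SS SY) as (y & Sy & yu & yv).
{ intros u v Huv; rewrite (is_derive_unique _ _ _ (DY u v Huv) : Du Y u v = _).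
  apply is_derive_unique, HCS, Huv. }
destruct (poincare_simply_connected U (fun u v => y u v * C u v - x u v * S u v)
   (fun u v => y u v * X u v - x u v * Y u v + c u v) HU Hsc) as (z & Sz & zu & zv).
{ apply smooth2_minus; [exact HU| |]; apply smooth2_mult; assumption. }
{ apply smooth2_plus; [exact HU| |exact Sc].
  apply smooth2_minus; [exact HU| |]; apply smooth2_mult; assumption. }
{ intros u v Huv; destruct (HCS u v Huv) as (_ & _ & C2 & S2).
  assert (xu' := xu u v Huv); assert (xv' := xv u v Huv).
  assert (yu' := yu u v Huv); assert (yv' := yv u v Huv).
  assert (DX' := DX u v Huv); assert (DY' := DY u v Huv); assert (Dc' := Dc u v Huv).
  (* Closedness of the form for [z]: one mixed derivative contains [Y C - X S = b], the other
     [S X - C Y = - b] plus [c_u = 2 b]. *)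
  transitivity (b u v * (C u v * C u v + S u v * S u v)
    - y u v * (Du b u v * S u v) - x u v * (Du b u v * C u v)).
  - apply is_derive_unique; derive_arith; unfold X, Y; ring.
  - symmetry; apply is_derive_unique; derive_arith.
    transitivity (2 * b u v - b u v * (C u v * C u v + S u v * S u v)
      - y u v * (Du b u v * S u v) - x u v * (Du b u v * C u v)).
    + unfold X, Y; ring.
    + rewrite HN; ring. }
exists (fun u v => (x u v, y u v, z u v)).
apply (normal_of_structure U x y z C S (fun u v => y u v * C u v - x u v * S u v)); try assumption.
intros u v Huv; destruct (HCS u v Huv) as (C1 & S1 & C2 & S2).
exact (conj (HN u v) (conj eq_refl (conj (xu u v Huv) (conj (yu u v Huv) (conj (zu u v Huv)
  (conj (xv u v Huv) (conj (yv u v Huv) (conj (zv u v Huv)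
  (conj C1 (conj S1 (conj C2 S2))))))))))).
Qed.

(** * Heisenberg rigid motions *)

Lemma affine_partials (f : H1 -> R) (A B C D : R) :
  (forall p, f p = A * cx p + B * cy p + C * cz p + D) -> forall p,
  (ex_Dx f p /\ ex_Dy f p /\ ex_Dz f p) /\
  Defs.Dx f p = A /\ Defs.Dy f p = B /\ Defs.Dz f p = C.
Proof.
intros Hf [[x y] z].
assert (K : forall k l t : R, is_derive (fun t => k * t + l) t k).
{ intros k l t; auto_derive; [exact I|ring]. }
assert (Kx : is_derive (fun t : R => f (t, y, z)) x A).
{ apply (is_derive_ext (fun t => A * t + (B * y + C * z + D))); [|apply K].
  intros t; rewrite Hf; unfold cx, cy, cz; simpl; ring. }
assert (Ky : is_derive (fun t : R => f (x, t, z)) y B).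
{ apply (is_derive_ext (fun t => B * t + (A * x + C * z + D))); [|apply K].
  intros t; rewrite Hf; unfold cx, cy, cz; simpl; ring. }
assert (Kz : is_derive (fun t : R => f (x, y, t)) z C).
{ apply (is_derive_ext (fun t => C * t + (A * x + B * y + D))); [|apply K].
  intros t; rewrite Hf; unfold cx, cy, cz; simpl; ring. }
repeat split; try (eexists; eassumption); apply is_derive_unique; assumption.
Qed.

(** The partials of an affine function are constants, hence affine again, so the induction on the
    order runs over all affine functions at once. *)
Lemma smooth3_affine (f : H1 -> R) (A B C D : R) :
  (forall p, f p = A * cx p + B * cy p + C * cz p + D) -> smooth3 f.
Proof.
assert (Hcont : forall (f : H1 -> R) A B C D,
  (forall p, f p = A * cx p + B * cy p + C * cz p + D) -> forall p, continuous f p).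
{ clear; intros f A B C D Hf p.
  apply (continuous_ext _ f p (fun p => eq_sym (Hf p))).
  assert (Kx : continuous (fun p : R * R * R => cx p) p).
  { apply (continuous_comp fst fst); apply continuous_fst. }
  assert (Ky : continuous (fun p : R * R * R => cy p) p).
  { apply (continuous_comp fst snd); [apply continuous_fst|apply continuous_snd]. }
  assert (Kz : continuous (fun p : R * R * R => cz p) p) by apply continuous_snd.
  assert (L : forall k (h : R * R * R -> R), continuous h p -> continuous (fun p => k * h p) p).
  { intros k h Hh; apply (continuous_mult (fun _ => k) h); [apply continuous_const|exact Hh]. }
  apply (continuous_plus (fun p : R * R * R => A * cx p + B * cy p + C * cz p) (fun _ => D));
    [|apply continuous_const].
  apply (continuous_plus (fun p : R * R * R => A * cx p + B * cy p) (fun p => C * cz p));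
    [|apply L, Kz].
  apply (continuous_plus (fun p : R * R * R => A * cx p) (fun p => B * cy p));
    [apply L, Kx|apply L, Ky]. }
intros Hf p n; revert p f A B C D Hf; induction n as [|n IH]; intros p f A B C D Hf;
  (split; [apply (Hcont f A B C D Hf)|]); [exact I|].
split; [apply (affine_partials f A B C D Hf)|].
split; [|split].
- apply (IH p _ 0 0 0 A); intros q; destruct (affine_partials f A B C D Hf q) as (_ & -> & _); ring.
- apply (IH p _ 0 0 0 B); intros q; destruct (affine_partials f A B C D Hf q) as (_ & _ & -> & _); ring.
- apply (IH p _ 0 0 0 C); intros q; destruct (affine_partials f A B C D Hf q) as (_ & _ & _ & ->); ring.
Qed.

Lemma dfun_affine (f : H1 -> R) (A B C D : R) :
  (forall p, f p = A * cx p + B * cy p + C * cz p + D) -> forall p v,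
  dfun f p v = A * cx v + B * cy v + C * cz v.
Proof.
intros Hf p v; unfold dfun; destruct (affine_partials f A B C D Hf p) as (_ & -> & -> & ->).
reflexivity.
Qed.

(* Rotation by the angle with cosine al and sine be, followed by the left translation by
   (x0, y0, z0). *)
Definition rigid (al be x0 y0 z0 : R) (p : H1) : H1 :=
  (al * cx p - be * cy p + x0, be * cx p + al * cy p + y0,
   cz p + y0 * (al * cx p - be * cy p) - x0 * (be * cx p + al * cy p) + z0).

Lemma rigid_PSH1 (al be x0 y0 z0 : R) : al * al + be * be = 1 ->
  PSH1 (rigid al be x0 y0 z0).
Proof.
intros N.
assert (Hx : forall al be x0 y0 z0 p,
  cx (rigid al be x0 y0 z0 p) = al * cx p + - be * cy p + 0 * cz p + x0).
{ intros; unfold rigid, cx; simpl; ring. }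
assert (Hy : forall al be x0 y0 z0 p,
  cy (rigid al be x0 y0 z0 p) = be * cx p + al * cy p + 0 * cz p + y0).
{ intros; unfold rigid, cy; simpl; ring. }
assert (Hz : forall al be x0 y0 z0 p, cz (rigid al be x0 y0 z0 p) =
  (y0 * al - x0 * be) * cx p + (- y0 * be - x0 * al) * cy p + 1 * cz p + z0).
{ intros; unfold rigid, cz; simpl; ring. }
assert (Hsm : forall al be x0 y0 z0, smooth_map (rigid al be x0 y0 z0)).
{ intros; split; [|split]; eapply smooth3_affine; intros; [apply Hx|apply Hy|apply Hz]. }
assert (Hd : forall p v, dmap (rigid al be x0 y0 z0) p v =
  (al * cx v - be * cy v, be * cx v + al * cy v,
   cz v + y0 * (al * cx v - be * cy v) - x0 * (be * cx v + al * cy v))).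
{ intros p v; unfold dmap.
  rewrite (dfun_affine _ _ _ _ _ (Hx _ _ _ _ _)), (dfun_affine _ _ _ _ _ (Hy _ _ _ _ _)),
    (dfun_affine _ _ _ _ _ (Hz _ _ _ _ _)).
  apply H1_eq; unfold cx, cy, cz; simpl; ring. }
split; [split; [apply Hsm|]|split].
(* Rotations are group automorphisms fixing [z], so the inverse rotates by the opposite angle and
   translates by the negative of the rotated-back vector, with height [- z0]. *)
- set (x1 := - (al * x0 + be * y0)); set (y1 := be * x0 - al * y0).
  exists (rigid al (- be) x1 y1 (- z0)); split; [apply Hsm|].
  split; intros [[x y] z]; unfold rigid, x1, y1, cx, cy, cz; simpl.
  + f_equal; [f_equal|].
    * transitivity ((al * al + be * be) * x); [ring|rewrite N; ring].
    * transitivity ((al * al + be * be) * y); [ring|rewrite N; ring].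
    * transitivity (z + (1 - (al * al + be * be)) *
        (y0 * (al * x - be * y + x0) - x0 * (be * x + al * y + y0))); [ring|rewrite N; ring].
  + f_equal; [f_equal|].
    * transitivity ((al * al + be * be) * (x - x0) + x0); [ring|rewrite N; ring].
    * transitivity ((al * al + be * be) * (y - y0) + y0); [ring|rewrite N; ring].
    * ring.
(* The translation terms cancel, and the rotation preserves [x dy - y dx]. *)
- intros p v; rewrite Hd; unfold theta0, rigid, cx, cy, cz; simpl.
  transitivity (snd v + (al * al + be * be) * (fst (fst p) * snd (fst v) - snd (fst p) * fst (fst v)));
    [ring|rewrite N; ring].
- intros p v _; rewrite Hd, !J0E, Hd; apply H1_eq; unfold rigid, cx, cy, cz; simpl; try ring.
  transitivity (- (al * al + be * be) * (fst (fst p) * fst (fst v) + snd (fst p) * snd (fst v))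
   - x0 * (al * fst (fst v) - be * snd (fst v)) - y0 * (be * fst (fst v) + al * snd (fst v)));
   [rewrite N|]; ring.
Qed.

(** * Uniqueness up to a rigid motion *)

Lemma structure_unique (U : R * R -> Prop) (x y z p q r x' y' z' p' q' r' a b c : R -> R -> R) :
  open U -> path_connected U -> (exists o, U o) ->
  (forall u v, U (u, v) -> structure_eqs x y z p q r a b c u v) ->
  (forall u v, U (u, v) -> structure_eqs x' y' z' p' q' r' a b c u v) ->
  exists al be x0 y0 z0, al * al + be * be = 1 /\ forall u v, U (u, v) ->
    (x' u v, y' u v, z' u v) = rigid al be x0 y0 z0 (x u v, y u v, z u v).
Proof.
intros HU Hpc [[u0 v0] Ho] H H'.
assert (const := fun f Hu Hv u v Huv => zero_gradient_constant U f HU Hpc Hu Hv u v u0 v0 Huv Ho).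
(* Cosine and sine of the angle from [(p, q)] to [(p', q')] at the base point. *)
set (al := p' u0 v0 * p u0 v0 + q' u0 v0 * q u0 v0).
set (be := q' u0 v0 * p u0 v0 - p' u0 v0 * q u0 v0).
assert (Hal : forall u v, U (u, v) -> p' u v * p u v + q' u v * q u v = al).
{ apply (const (fun u v => p' u v * p u v + q' u v * q u v)); intros u v Huv;
  destruct (H u v Huv) as (_ & _ & _ & _ & _ & _ & _ & _ & Pu & Qu & Pv & Qv);
  destruct (H' u v Huv) as (_ & _ & _ & _ & _ & _ & _ & _ & Pu' & Qu' & Pv' & Qv');
  derive_arith; ring. }
assert (Hbe : forall u v, U (u, v) -> q' u v * p u v - p' u v * q u v = be).
{ apply (const (fun u v => q' u v * p u v - p' u v * q u v)); intros u v Huv;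
  destruct (H u v Huv) as (_ & _ & _ & _ & _ & _ & _ & _ & Pu & Qu & Pv & Qv);
  destruct (H' u v Huv) as (_ & _ & _ & _ & _ & _ & _ & _ & Pu' & Qu' & Pv' & Qv');
  derive_arith; ring. }
assert (N : al * al + be * be = 1).
{ destruct (H u0 v0 Ho) as (E & _), (H' u0 v0 Ho) as (E' & _).
  (* The product identity for sums of two squares. *)
  transitivity ((p' u0 v0 * p' u0 v0 + q' u0 v0 * q' u0 v0) * (p u0 v0 * p u0 v0 + q u0 v0 * q u0 v0));
    [unfold al, be|rewrite E, E']; ring. }
assert (Hp : forall u v, U (u, v) -> p' u v = al * p u v - be * q u v /\
                                     q' u v = be * p u v + al * q u v).
{ intros u v Huv; destruct (H u v Huv) as (E & _).
  rewrite <- (Hal u v Huv), <- (Hbe u v Huv); split.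
  - transitivity (p' u v * (p u v * p u v + q u v * q u v)); [rewrite E|]; ring.
  - transitivity (q' u v * (p u v * p u v + q u v * q u v)); [rewrite E|]; ring. }
clearbody al be; clear Hal Hbe.
set (x0 := x' u0 v0 - (al * x u0 v0 - be * y u0 v0)).
set (y0 := y' u0 v0 - (be * x u0 v0 + al * y u0 v0)).
assert (Hx : forall u v, U (u, v) -> x' u v - (al * x u v - be * y u v) = x0).
{ apply (const (fun u v => x' u v - (al * x u v - be * y u v))); intros u v Huv;
  destruct (Hp u v Huv) as [Ep Eq];
  destruct (H u v Huv) as (_ & _ & Xu & Yu & _ & Xv & Yv & _);
  destruct (H' u v Huv) as (_ & _ & Xu' & Yu' & _ & Xv' & Yv' & _);
  derive_arith; rewrite ?Ep, ?Eq; ring. }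
assert (Hy : forall u v, U (u, v) -> y' u v - (be * x u v + al * y u v) = y0).
{ apply (const (fun u v => y' u v - (be * x u v + al * y u v))); intros u v Huv;
  destruct (Hp u v Huv) as [Ep Eq];
  destruct (H u v Huv) as (_ & _ & Xu & Yu & _ & Xv & Yv & _);
  destruct (H' u v Huv) as (_ & _ & Xu' & Yu' & _ & Xv' & Yv' & _);
  derive_arith; rewrite ?Ep, ?Eq; ring. }
clearbody x0 y0.
assert (Hx' : forall u v, U (u, v) -> x' u v = al * x u v - be * y u v + x0).
{ intros u v Huv; rewrite <- (Hx u v Huv); ring. }
assert (Hy' : forall u v, U (u, v) -> y' u v = be * x u v + al * y u v + y0).
{ intros u v Huv; rewrite <- (Hy u v Huv); ring. }
(* The excess of [z'] over the third coordinate of [rigid] without its constant; its value at the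
   base point will be the vertical translation. *)
set (f := fun u v => z' u v - (z u v + y0 * (al * x u v - be * y u v) - x0 * (be * x u v + al * y u v))).
assert (Hz : forall u v, U (u, v) -> f u v = f u0 v0).
{ apply const; intros u v Huv; unfold f;
  destruct (Hp u v Huv) as [Ep Eq];
  assert (Ex := Hx' u v Huv); assert (Ey := Hy' u v Huv);
  destruct (H u v Huv) as (_ & Er & Xu & Yu & Zu & Xv & Yv & Zv & _);
  destruct (H' u v Huv) as (_ & Er' & Xu' & Yu' & Zu' & Xv' & Yv' & Zv' & _);
  derive_arith; rewrite ?Er, ?Er', Ep, Eq, Ex, Ey.
  - transitivity ((al * al + be * be - 1) * (y u v * p u v - x u v * q u v)); [ring|rewrite N; ring].
  - transitivity ((al * al + be * be - 1) * (y u v * (a u v * p u v - b u v * q u v)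
      - x u v * (a u v * q u v + b u v * p u v))); [ring|rewrite N; ring]. }
exists al, be, x0, y0, (f u0 v0); split; [exact N|]; intros u v Huv.
rewrite <- (Hz u v Huv); apply H1_eq; unfold rigid, f, cx, cy, cz; simpl.
- apply Hx', Huv.
- apply Hy', Huv.
- ring.
Qed.

(** The hypothesis [c_neq0] expresses a necessary condition: by [normal_coef_c_neq0], the
    coefficient [c] of a normal surface vanishes nowhere. *)
Theorem theorem1p9 (U : R * R -> Prop) (a b c : R -> R -> R)
    (U_open : open U) (U_sc : simply_connected U)
    (a_smooth : smooth2 U a) (b_smooth : smooth2 U b) (c_smooth : smooth2 U c)
    (c_neq0 : forall u v, U (u, v) -> c u v <> 0)
    (a_int : forall u v, U (u, v) -> Du a u v = 0)
    (b_int : forall u v, U (u, v) -> Du (Du b) u v = 0)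
    (c_int : forall u v, U (u, v) -> Du c u v = 2 * b u v) :
  exists F : R -> R -> H1,
    normal_pminimal U F /\
    has_first_coefs U F a b c /\
    (forall u v, U (u, v) -> coef_m F u v = Du b u v) /\
    (forall F' : R -> R -> H1,
       normal_pminimal U F' -> has_first_coefs U F' a b c ->
       exists g : H1 -> H1,
         PSH1 g /\ forall u v, U (u, v) -> F' u v = g (F u v)).
Proof.
destruct (normal_pminimal_exists U a b c) as (F & HF & Hco); try assumption.
assert (St := normal_pminimal_structure U F a b c U_open a_smooth b_smooth a_int HF Hco).
exists F; split; [exact HF|]; split; [exact Hco|]; split.
- intros u v Huv; unfold coef_m, frameY; rewrite metric_J0; unfold frameX.
  destruct (St u v Huv) as (N & _ & _ & _ & _ & _ & _ & _ & _ & _ & Pv & Qv).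
  rewrite (is_derive_unique _ _ _ Pv : cx (DFv (DFu F) u v) = _),
    (is_derive_unique _ _ _ Qv : cy (DFv (DFu F) u v) = _).
  (* Here [m = q_v p - p_v q], and the structure equations turn this into [b_u (p^2 + q^2)]. *)
  transitivity (Du b u v * (cx (DFu F u v) * cx (DFu F u v) + cy (DFu F u v) * cy (DFu F u v)));
    [ring|rewrite N; ring].
- intros F' HF' Hco'.
  assert (St' := normal_pminimal_structure U F' a b c U_open a_smooth b_smooth a_int HF' Hco').
  destruct (classic (exists o, U o)) as [Ho|Hempty].
  + destruct (structure_unique U _ _ _ _ _ _ _ _ _ _ _ _ a b c U_open (proj1 U_sc) Ho St St')
      as (al & be & x0 & y0 & z0 & N & E).
    exists (rigid al be x0 y0 z0); split; [apply rigid_PSH1, N|].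
    intros u v Huv; specialize (E u v Huv).
    destruct (F u v) as [[x y] z], (F' u v) as [[x' y'] z']; exact E.
  (* Over an empty [U] there is nothing to compare, and the identity motion serves. *)
  + exists (rigid 1 0 0 0 0); split; [apply rigid_PSH1; ring|].
    intros u v Huv; elim Hempty; exists (u, v); exact Huv.
Qed.
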